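(* Let $p_0$ be the true density of a single observation. Let $\pi(m,df)=\pi_m\,\pi(df\mid m)$ be a model-averaging prior over model indexes $m\in M$ and densities $f\in\mathcal{P}_m$, where the models are nonoverlapping, and let $p=p^{(n)}$, $n=1,2,\dots$, be a posterior sequence of random densities for iid data under this prior. Let $u\in\{1/2,1/3,1/4,\dots\}$ and $0<t<\infty$, and for each $n$ and $m$ let $\overline{N}_m=N((1/n)^{1/u},L_1,\mathcal{P}_m)$ be the (finite) number of $L_1$ balls of radius $(1/n)^{1/u}$ needed to cover $\mathcal{P}_m$. Then, with probability $1$, for all sufficiently large sample sizes $n$, $$d_{-u}^2(p_0,p^{(n)})\le d_t^2(p_0,\pi)+n^{-1}\ln\left(n^{2(u^{-1}+t^{-1})}\Bigl(\sum_{m\in M}\pi_m^u\,\overline{N}_m\Bigr)^{1/u}\right),$$ where $$d_t^2(p_0,\pi)\equiv\inf_{K\subset\mathcal{P}}\left\{\sup_{q\in K}d_t^2(p_0,q)-n^{-1}\ln\pi(K)\right\}$$ $$\le\inf_{m\in M,\,K_m\subset\mathcal{P}_m}\left\{\sup_{q\in K_m}d_t^2(p_0,q)-n^{-1}\ln\left[\pi_m\,\pi(K_m\mid m)\right]\right\}=\inf_{m\in M}\left[d_t^2(p_0,\pi(\cdot\mid m))-n^{-1}\ln\pi_m\right].$$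
   Context: All densities are probability densities of a single observation $Y$ with respect to a common dominating measure. All sets to which priors are applied are measurable. An $L_1$ ball of radius $r$ is a ball in the set of densities for the distance $\int|f-g|$. Prior: $M$ is a countable set of model indexes, $\pi_m$ ($m\in M$) are model probabilities, $\pi(df\mid m)$ is the prior given model $m$, with support $\mathcal{P}_m$, and $\mathcal{P}_m\cap\mathcal{P}_{m'}=\emptyset$ for $m\ne m'$ (nonoverlapping models). The mixing prior is $\pi(df)=\sum_{m\in M}\pi_m\,\pi(df\mid m)$, with support $\mathcal{P}=\bigcup_{m\in M}\mathcal{P}_m$. Divergence: for $t>-1$, $t\ne0$, and densities $p,q$, $d_t^2(p,q)=t^{-1}\int p\left((p/q)^t-1\right)$, i.e. $1+t\,d_t^2(p,q)=\int p^{1+t}q^{-t}$ (for $t>0$ this is $+\infty$ if $q=0$ on a set of positive $p$-probability; points with $p=0$ contribute $0$). Penalized divergence of a prior: for a prior $\rho$ with support $\mathcal{S}$, $d_t^2(p_0,\rho)=\inf_{K\subset\mathcal{S}}\left[\sup_{q\in K}d_t^2(p_0,q)-n^{-1}\ln\rho(K)\right]$ (dependent on $n$); this is used for $\rho=\pi$, $\mathcal{S}=\mathcal{P}$ and for $\rho=\pi(\cdot\mid m)$, $\mathcal{S}=\mathcal{P}_m$. The convention $-\ln 0=+\infty$ is used. Posterior sequence of random densities for iid data: a sequence $p^{(n)}$ (labeled by the sample size $n$) of random density functions in $\mathcal{P}$, defined on one probability space, such that for every $n$ and every subset $A\subset\mathcal{P}$, $$\Pr\left[p^{(n)}\in A\right]=\int\left[\frac{\int_{f\in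 A}\prod_{i=1}^nf(Y_i)\,\pi(df)}{\int_{f\in\mathcal{P}}\prod_{i=1}^nf(Y_i)\,\pi(df)}\right]\prod_{i=1}^np_0(Y_i)\,dY_i ,$$ the ratio being assumed well defined almost surely. That is, for each $n$, $p^{(n)}$ is marginally distributed as a draw from the posterior given $n$ iid observations from $p_0$; nothing is assumed about the joint law across different $n$. The bound is trivial when its right-hand side is $+\infty$ (e.g. when $\sum_m\pi_m^u\overline{N}_m=\infty$). *)

(* Defs.v *)
From HB Require Import structures.
From mathcomp Require Import all_boot all_order all_algebra.
From mathcomp Require Import all_classical all_reals all_analysis.

Set Implicit Arguments.
Unset Strict Implicit.
Unset Printing Implicit Defensive.

Import Order.TTheory GRing.Theory Num.Theory.
Import numFieldNormedType.Exports.

Local Open Scope classical_set_scope.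
Local Open Scope ring_scope.
Local Open Scope ereal_scope.

Section densities.
Context (d : measure_display) (Y : measurableType d) (R : realType).
Variable mu : {measure set Y -> \bar R}.
Implicit Types (f g p q : Y -> R) (t r : R) (n : nat).

Definition is_density f : Prop :=
  [/\ measurable_fun [set: Y] f, (forall y, (0 <= f y)%R)
    & \int[mu]_y (f y)%:E = 1].

Definition L1_dist f g : \bar R := \int[mu]_y (`|f y - g y|%R)%:E.

(* Closed balls, with densities as centres.  Open balls can only need more
   balls for a cover. *)
Definition L1_ball f r : set (Y -> R) :=
  [set g | is_density g /\ L1_dist f g <= r%:E].

(* +oo when no finite cover exists. *)
Definition covering_number r (S : set (Y -> R)) : \bar R :=
  ereal_inf [set (k%:R)%:E | k in
    [set k : nat | exists2 c : 'I_k -> Y -> R,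
       (forall i, is_density (c i)) & S `<=` \bigcup_i L1_ball (c i) r]].

(* p ((p / q)^t - 1), with the value 0 where p = 0; where q = 0 < p, the power
   (p / q)^t is +oo if 0 < t, and 0 if t < 0. *)
Definition divergence_integrand t p q (y : Y) : \bar R :=
  if p y == 0%R then 0
  else if q y == 0%R then (if (0 < t)%R then +oo else (- p y)%:E)
  else (p y * ((p y / q y) `^ t - 1))%:E.

(* d_t^2(p, q), for -1 < t and t != 0 *)
Definition divergence t p q : \bar R :=
  (t^-1)%:E * \int[mu]_y divergence_integrand t p q y.

Definition likelihood f (s : seq Y) : R := (\prod_(y <- s) f y)%R.

(* The integral of g(Y_1, ..., Y_n) dY_1 ... dY_n, as an iterated integral
   with respect to mu. *)
Fixpoint iterated_integral n (g : seq Y -> \bar R) : \bar R :=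
  if n is n'.+1 then
    \int[mu]_y iterated_integral n' (fun s => g (y :: s))
  else g [::].

(* An arbitrary sigma-algebra on the functions Y -> R is given by a family G of
   generators; priors are measures on that sigma-algebra. *)
Context (G : set (set (Y -> R))).
Local Notation F := (g_sigma_algebraType G).

(* K is nonempty: a null K contributes +oo through - ln 0, whereas the
   supremum over the empty set would be -oo in \bar R. *)
Definition penalized_divergence n t p (rho : set F -> \bar R) (S : set F) :
    \bar R :=
  ereal_inf [set ereal_sup [set divergence t p q | q in K]
                   - (n%:R^-1)%:E * lne (rho K)
            | K in [set K : set F | [/\ measurable K, K !=set0 & K `<=` S]]].

Definition integrated_likelihood (pr : {measure set F -> \bar R}) (A : set F)
    (s : seq Y) : \bar R :=
  \int[pr]_(f in A) (likelihood f s)%:E.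

Definition posterior (pr : {measure set F -> \bar R}) (S A : set F)
    (s : seq Y) : \bar R :=
  integrated_likelihood pr A s / integrated_likelihood pr S s.

Definition posterior_well_defined n (pr : {measure set F -> \bar R})
    (S : set F) p : Prop :=
  iterated_integral n (fun s =>
    (\1_[set s | ~ (0 < integrated_likelihood pr S s < +oo)%E] s)%:E
    * (likelihood p s)%:E) = 0.

(* Only the marginal laws are constrained, nothing is said of the joint law
   of the rho n. *)
Definition posterior_sequence (d' : measure_display) (T : measurableType d')
    (Pr : probability T R) (pr : {measure set F -> \bar R}) (S : set F) p
    (rho : nat -> T -> F) : Prop :=
  forall n, (0 < n)%N ->
  [/\ measurable_fun [set: T] (rho n),
      (forall w, S (rho n w)),
      posterior_well_defined n pr S p
    & forall A : set F, measurable A -> A `<=` S ->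
        Pr (rho n @^-1` A) =
        iterated_integral n (fun s => posterior pr S A s * (likelihood p s)%:E)].

End densities.

(* The number pi_m of a model and its prior pi(. | m) are w m and prm m; the
   "support" of prm m is a measurable set S m of densities of full prior
   probability.  The last condition, joint measurability of (f, y) |-> f y on
   the union of the supports, is what gives a meaning to the integrals of the
   likelihood with respect to the prior. *)
Record mixing_prior (d : measure_display) (Y : measurableType d) (R : realType)
    (mu : {measure set Y -> \bar R}) (G : set (set (Y -> R))) (M : countType)
    (w : M -> R) (prm : M -> probability (g_sigma_algebraType G) R)
    (S : M -> set (g_sigma_algebraType G))
    (pr : probability (g_sigma_algebraType G) R) : Prop := {
  weights_ge0 : forall m, (0 <= w m)%R;
  weights_sum1 : \esum_(m in [set: M]) (w m)%:E = 1;
  supports_measurable : forall m, measurable (S m);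
  supports_density : forall m, S m `<=` is_density mu;
  supports_full : forall m, prm m (S m) = 1;
  nonoverlapping : trivIset [set: M] S;
  mixtureE : forall A, measurable A ->
    pr A = \esum_(m in [set: M]) ((w m)%:E * prm m A);
  evaluation_measurable :
    measurable_fun ((\bigcup_m S m) `*` [set: Y])
      (fun z : g_sigma_algebraType G * Y => (z.1 : Y -> R) z.2)
}.

(* Main.v *)
(* With P the union of the supports, fix n, let A be the set of f in P that
   violate the bound, and write Z_B for the integral over B of the likelihood
   L_f under the prior and L_0 for the likelihood of p0.  Let K nearly attain
   d_t^2(p0, pi).  On {Z_K >= b pi(K) L_0} the posterior mass Z_A / Z_P, being
   at most 1, is at most its power u, hence at most
   (b pi(K) L_0)^(-u) sum_i Z_(D_i)^u, where the D_i are the pieces of A cut out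
   by the L1 balls that cover the models; the complementary event has
   probability at most b^t (1 + t sup_K d_t^2)^n.  Both estimates are integrated
   one observation at a time, for arbitrary weights on the densities, so that no
   measurability on Y^n is required: a mixture of densities in D_i stays within
   twice the radius, 2 n^(-1/u), of any single one of them, whence one observation
   multiplies the bound for Z_(D_i)^u by at most 1 - u eps + 2^u / n.  With
   b = exp(-n sup_K d_t^2) n^(-2/t) the posterior mass of A is O(n^-2) on average,
   and the Borel-Cantelli lemma concludes. *)

Require Import Defs.
From HB Require Import structures.
From mathcomp Require Import all_boot all_order all_algebra.
From mathcomp Require Import all_classical all_reals all_analysis.
From mathcomp Require Import measurable_realfun ring lra.

Set Implicit Arguments.
Unset Strict Implicit.
Unset Printing Implicit Defensive.

Import Order.TTheory GRing.Theory Num.Theory.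
Import numFieldNormedType.Exports.

Local Open Scope classical_set_scope.
Local Open Scope ring_scope.
Local Open Scope ereal_scope.

(** * Powers and integrals without measurability *)

Section real_inequalities.
Context {R : realType}.
Implicit Types a b c l x : R.
Local Open Scope ring_scope.

Lemma young_powR a b (u : R) : 0 <= a -> 0 <= b -> 0 < u < 1 ->
  a `^ (1 - u) * b `^ u <= (1 - u) * a + u * b.
Proof.
move=> a0 b0 /andP[u0 u1]; have u1' : 0 < 1 - u by rewrite subr_gt0.
have := @conjugate_powR R (a `^ (1 - u)) (b `^ u) (1 - u)^-1 u^-1
  (powR_ge0 _ _) (powR_ge0 _ _).
rewrite !invr_gt0 !invrK subrK => /(_ u1' u0 erefl).
by rewrite -!powRrM !mulfV ?gt_eqF// !powRr1// (mulrC a) (mulrC b).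
Qed.

(** The convex function [x^(-t)] lies above its tangent at 1; the linear bounds on [expR] and [ln]
    suffice. *)
Lemma powRN_tangent x (t : R) : 0 < x -> 0 < t -> 1 + t <= (x `^ t)^-1 + t * x.
Proof.
move=> x0 t0; rewrite -powRN /powR gt_eqF//.
have h1 := expR_ge1Dx (- t * ln x).
have h2 : t * ln x <= t * (x - 1).
  rewrite ler_pM2l//; have := @le_ln1Dx R (x - 1); rewrite subrKC; apply.
  by rewrite ltrBrDl addrN.
lra.
Qed.

(** The tangent inequality at [x = l / (b * l0)], multiplied by [b^(-t) * l0]. Here [l0] stands for
    the likelihood of the true density and [l] for that of another one. *)
Lemma powRN_tangent_scaled b (t : R) l0 l : 0 < b -> 0 < t -> 0 < l0 -> 0 < l ->
  (1 + t) * (b `^ t)^-1 * l0 <=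
  l0 `^ (1 + t) * (l `^ t)^-1 + t * (b `^ t)^-1 * b^-1 * l.
Proof.
move=> b0 t0 l00 lgt0.
have x0 : 0 < l / (b * l0) by rewrite divr_gt0// mulr_gt0.
have := powRN_tangent x0 t0.
have c0 : 0 < (b `^ t)^-1 * l0 by rewrite mulr_gt0// invr_gt0 powR_gt0.
rewrite -(ler_pM2r c0) [leLHS]mulrA [in leRHS]mulrDl => /le_trans; apply.
rewrite le_eqVlt; apply/orP; left; apply/eqP; congr (_ + _).
  have bl0 : 0 < b * l0 by rewrite mulr_gt0.
  have -> : (l / (b * l0)) `^ t = l `^ t / (b `^ t * l0 `^ t).
    rewrite powRM ?invr_ge0 ?(ltW lgt0) ?(ltW bl0)//; congr (_ * _).
    by rewrite -powR_inv1 ?ltW// powRAC powR_inv1 ?powR_ge0// powRM ?ltW.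
  rewrite powRD; last by rewrite (gt_eqF l00) implybT.
  rewrite powRr1 ?ltW//.
  have p1 := powR_gt0 t b0; have p2 := powR_gt0 t lgt0; have p3 := powR_gt0 t l00.
  by field; rewrite !gt_eqF.
have p1 := powR_gt0 t b0.
by field; rewrite !gt_eqF.
Qed.

End real_inequalities.

Section poweR_subadditive.
Context {R : realType}.
Implicit Types (x y : \bar R).

Lemma le_poweR x y (r : R) : (0 <= r)%R -> 0 <= x -> x <= y -> x `^ r <= y `^ r.
Proof.
by move=> r0 x0 xy; apply: gt0_ler_poweR => //; rewrite in_itv/= leey ?x0 ?(le_trans x0).
Qed.

Lemma poweRrVK x (u : R) : (0 < u)%R -> 0 <= x -> (x `^ u) `^ u^-1 = x.
Proof. by move=> u0 x0; rewrite -poweRrM mulfV ?gt_eqF// poweRe1. Qed.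

(** With [W] the right-hand side, every [x i ^ u] is at most [W], hence
    [x i <= W^(1/u - 1) * x i ^ u]; summing gives at most [W^(1/u)]. *)
Lemma poweR_nneseries_le (x : nat -> \bar R) (u : R) : (0 < u < 1)%R ->
  (forall i, 0 <= x i) ->
  (\sum_(i <oo) x i) `^ u <= \sum_(i <oo) (x i) `^ u.
Proof.
move=> /andP[u0 u1] x0.
set W := \sum_(i <oo) (x i) `^ u.
have xu0 i : 0 <= x i `^ u by exact: poweR_ge0.
have W0 : 0 <= W by exact: nneseries_ge0.
have [->|] := eqVneq W +oo; first exact: leey.
rewrite -ltey => Wlty.
have Wfin : W \is a fin_num by rewrite ge0_fin_numE.
have xW i : x i `^ u <= W.
  rewrite /W (@nneseriesD1 _ _ i)// leeDl//.
  exact: nneseries_ge0.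
have key : \sum_(i <oo) x i <= W `^ u^-1.
  have [W00|Wn0] := eqVneq W 0.
    rewrite W00 poweR0r ?invr_eq0 ?gt_eqF// eseries0// => i _ _.
    by apply/(@poweR_eq0_eq0 _ _ u) => //; apply/eqP; rewrite eq_le xu0 andbT -W00.
  have Wgt0 : (0 < fine W)%R by rewrite fine_gt0// lt0e Wn0 W0.
  have xle i : x i <= (fine W `^ (u^-1 - 1))%:E * x i `^ u.
    have : x i `^ u <= (fine W)%:E by rewrite fineK.
    rewrite -{2}(poweRrVK u0 (x0 i)).
    case: (x i `^ u) (xu0 i) => [r| |]//; rewrite !lee_fin => r0 rW.
    have [->|rn0] := eqVneq r 0%R; first by rewrite mulr0 powR0// invr_eq0 gt_eqF.
    rewrite -{1}(subrK 1%R u^-1%R) powRD; last by rewrite rn0 implybT.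
    rewrite powRr1// ler_wpM2r// ge0_ler_powR ?nnegrE// ?subr_ge0 ?fine_ge0//.
    by rewrite invf_ge1// ltW.
  apply: (le_trans (lee_nneseries _ (fun n _ => xle n))) => //.
  rewrite nneseriesZl// -/W -{2}(fineK Wfin) -EFinM -(fineK Wfin) poweR_EFin lee_fin.
  rewrite -{2}(powRr1 (ltW Wgt0)) -powRD; last by rewrite (gt_eqF Wgt0) implybT.
  by rewrite subrK.
apply: (le_trans (le_poweR (ltW u0) (nneseries_ge0 _) key)) => //.
by rewrite -poweRrM mulVf ?gt_eqF// poweRe1.
Qed.

Lemma poweRD_le x y (u : R) : (0 < u < 1)%R -> 0 <= x -> 0 <= y ->
  (x + y) `^ u <= x `^ u + y `^ u.
Proof.
move=> u01 x0 y0; have u0 : (u != 0)%R by rewrite gt_eqF//; case/andP : u01.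
have h i : 0 <= nth 0 [:: x; y] i by case: i => [|[|[|]]].
have := poweR_nneseries_le u01 h.
have aux (z : nat -> \bar R) : (forall i, 0 <= z i) ->
    (forall i, (2 <= i)%N -> z i = 0) -> \sum_(i <oo) z i = z 0%N + z 1%N.
  move=> z0 z2; rewrite (@nneseries_split _ _ 0 2)// [X in _ + X]eseries0// ?adde0.
    by rewrite !big_nat_recl// big_geq//= adde0.
  by move=> i ? _; exact: z2.
have z2 i : (2 <= i)%N -> nth 0 [:: x; y] i = 0 by case: i => [|[|[|]]].
rewrite !aux//= => [i|i i2]; first exact: poweR_ge0.
by rewrite z2// poweR0r.
Qed.

End poweR_subadditive.

Section iterated_integrals.
Context (d : measure_display) (Y : measurableType d) (R : realType).
Variable mu : {measure set Y -> \bar R}.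

(** The integral of a nonnegative function is a supremum over the simple functions below it, so
    monotonicity needs no measurability. This allows iterated integrals over the sample to be
    bounded although their integrands are not known to be measurable. *)
Lemma le_integralT_nonmeasurable (f g : Y -> \bar R) : (forall y, 0 <= f y) ->
  (forall y, f y <= g y) -> \int[mu]_y f y <= \int[mu]_y g y.
Proof.
move=> f0 fg; have g0 y : 0 <= g y by exact: le_trans (fg y).
rewrite !ge0_integralTE//; apply: le_ereal_sup => _ [h hf <-].
by exists h => // y; exact: le_trans (fg y).
Qed.

Lemma iterated_integral_ge0 n (g : seq Y -> \bar R) : (forall s, 0 <= g s) ->
  0 <= iterated_integral mu n g.
Proof.
elim: n g => [|n IH] g g0 //=; apply: integral_ge0 => y _; exact: IH.
Qed.

Lemma le_iterated_integral n (f g : seq Y -> \bar R) : (forall s, 0 <= f s) ->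
  (forall s, f s <= g s) -> iterated_integral mu n f <= iterated_integral mu n g.
Proof.
elim: n f g => [|n IH] f g f0 fg //=; apply: le_integralT_nonmeasurable => y.
  exact: iterated_integral_ge0.
exact: IH.
Qed.

End iterated_integrals.

(** * One observation *)

Section tonelli_on_a_domain.
Context (dF dY : measure_display) (F : measurableType dF) (Y : measurableType dY).
Context (R : realType).
Variables (nu : {sigma_finite_measure set F -> \bar R}).
Variables (mu : {sigma_finite_measure set Y -> \bar R}).
Variables (D : set F) (h : F * Y -> \bar R).
Hypotheses (mD : measurable D) (mh : measurable_fun [set: F * Y] h) (h0 : forall z, 0 <= h z).

(** Cutting [h] off to 0 outside [D] turns integrals over [D] into integrals over the whole space,
    where Tonelli's theorem applies. *)
Let hD := h \_ (D `*` [set: Y]).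

Let hDE f y : hD (f, y) = ((fun f => h (f, y)) \_ D) f.
Proof.
rewrite /hD !patchE; congr (if _ then _ else _).
by apply/idP/idP; rewrite !inE; [case|split].
Qed.

Let hD0 z : 0 <= hD z.
Proof. by apply: erestrict_ge0. Qed.

Let mhD : measurable_fun [set: F * Y] hD.
Proof.
apply/(measurable_restrictT _ _).1; last exact: measurable_funTS.
exact: measurableX.
Qed.

Lemma measurable_integral_section :
  measurable_fun setT (fun y => \int[nu]_(f in D) h (f, y)).
Proof.
have := @measurable_fun_fubini_tonelli_G _ _ _ _ _ nu hD mhD hD0.
apply: eq_measurable_fun => y _; rewrite /fubini_G [RHS]integral_mkcond.
by apply: eq_integral => f _; exact: hDE.
Qed.

Lemma tonelli_in : \int[mu]_y \int[nu]_(f in D) h (f, y) =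
  \int[nu]_(f in D) \int[mu]_y h (f, y).
Proof.
rewrite [RHS]integral_mkcond.
transitivity (\int[mu]_y \int[nu]_f hD (f, y)).
  by apply: eq_integral => y _; rewrite integral_mkcond; apply: eq_integral => f _; rewrite hDE.
rewrite -fubini_tonelli//; apply: eq_integral => f _.
rewrite patchE; case: ifPn => fD.
  by apply: eq_integral => y _; rewrite hDE patchE fD.
by apply: integral0_eq => y _; rewrite hDE patchE (negbTE fD).
Qed.

End tonelli_on_a_domain.

Section one_observation.
Context (dF dY : measure_display) (F : measurableType dF) (Y : measurableType dY).
Context (R : realType).
Variables (nu : {sigma_finite_measure set F -> \bar R}).
Variables (mu : {sigma_finite_measure set Y -> \bar R}).
Implicit Types (D K : set F) (u c : R).

(** After exchanging the integrals, the inner one is [h f] times a quantity at most [b]. This is the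
    effect of one observation on the part of the bound that comes from [K]. *)
Lemma integral_kernel_le K (phi : F * Y -> \bar R) (h : F -> \bar R) (b : R) :
  measurable K -> measurable_fun [set: F * Y] phi -> (forall z, 0 <= phi z) ->
  measurable_fun setT h -> (forall f, 0 <= h f) -> (0 <= b)%R ->
  (forall f, K f -> \int[mu]_y phi (f, y) <= b%:E) ->
  \int[mu]_y \int[nu]_(f in K) (h f * phi (f, y)) <= b%:E * \int[nu]_(f in K) h f.
Proof.
move=> mK mphi phi0 mh h0 b0 hb.
have mhphi : measurable_fun [set: F * Y] (fun z : F * Y => h z.1 * phi z).
  by apply: emeasurable_funM => //; exact: measurableT_comp.
rewrite (@tonelli_in _ _ _ _ _ nu mu K (fun z => h z.1 * phi z))//=; last first.
  by move=> z; rewrite mule_ge0.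
have mphi2 f : measurable_fun setT (fun y => phi (f, y)).
  by apply: measurableT_comp => //; exact: pair1_measurable.
rewrite -ge0_integralZl_EFin//; last exact: measurable_funTS.
rewrite [leLHS]integral_mkcond [leRHS]integral_mkcond.
apply: le_integralT_nonmeasurable => f; rewrite !patchE; case: ifPn => //.
  by move=> _; apply: integral_ge0 => y _; rewrite mule_ge0.
rewrite inE => Kf; rewrite ge0_integralZl//.
by rewrite muleC lee_wpmul2r// hb.
Qed.

(** Young's inequality for [p] and [x / c]. The scale [c] is free: if it bounds the integral of [x]
    and [p] is a density, the right-hand side integrates to at most [c^u]. *)
Lemma young_poweR_scaled (p u c : R) (x : \bar R) : (0 <= p)%R -> (0 < u < 1)%R ->
  (0 < c)%R -> 0 <= x ->
  (p `^ (1 - u))%:E * x `^ u <= (c `^ u)%:E * (((1 - u) * p)%:E + (u / c)%:E * x).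
Proof.
move=> p0 u01 c0; have /andP[u0 u1] := u01.
have cu0 := powR_gt0 u c0.
case: x => [r| |]// => [r0|_]; last first.
  rewrite (@gt0_muley _ (u / c)%:E) ?lte_fin ?divr_gt0// addey//.
  by rewrite gt0_muley ?lte_fin// leey.
rewrite lee_fin in r0.
suff : (p `^ (1 - u) * r `^ u <= c `^ u * ((1 - u) * p + u / c * r))%R.
  by rewrite -lee_fin.
have := young_powR p0 (divr_ge0 r0 (ltW c0)) u01.
rewrite -(ler_pM2l cu0) mulrCA -powRM ?divr_ge0 ?(ltW c0)//.
by rewrite mulrCA mulfV ?gt_eqF// mulr1 [(u / c * r)%R]mulrAC mulrA.
Qed.

Lemma integral_eq0_mul D (g : F -> R) (k : F -> R) : measurable D ->
  measurable_fun setT g -> (forall f, 0 <= g f)%R -> measurable_fun setT k ->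
  \int[nu]_(f in D) (g f)%:E = 0 -> \int[nu]_(f in D) (g f * k f)%:E = 0.
Proof.
move=> mD mg g0 mk hg.
have mg' : measurable_fun D (EFin \o g).
  by apply/measurable_EFinP; exact: measurable_funTS.
have /ae_eq_integral_abs : \int[nu]_(f in D) `|(EFin \o g) f| = 0.
  by rewrite -[RHS]hg; apply: eq_integral => f _ /=; rewrite ger0_norm.
move=> /(_ mD mg') aeg.
rewrite (ae_eq_integral (cst 0)) ?integral0//.
- apply/measurable_EFinP; apply: measurable_funTS; exact: measurable_funM.
- by apply: filterS aeg => f /= h Df; have [->] := h Df; rewrite mul0r.
Qed.

(* A mixture of the densities [e f], [f \in D], is compared with the single
   density [e q]: it is at most [G * e q + E], where [G] is the mass of the
   mixture and [E] has integral at most [c * G]. *)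
Lemma integral_mixture_poweR_le (p0 : Y -> R) (e : F * Y -> R) D (g : F -> R) u c a :
  measurable_fun setT p0 -> (forall y, 0 <= p0 y)%R -> \int[mu]_y (p0 y)%:E = 1 ->
  measurable_fun [set: F * Y] e -> (forall z, 0 <= e z)%R ->
  measurable D -> measurable_fun setT g -> (forall f, 0 <= g f)%R ->
  (0 < u < 1)%R -> (0 < c)%R ->
  (forall f q, D f -> D q -> \int[mu]_y (`|e (f, y) - e (q, y)|%R)%:E <= c%:E) ->
  (forall q, D q -> \int[mu]_y (p0 y `^ (1 - u) * e (q, y) `^ u)%:E <= a%:E) ->
  \int[mu]_y ((p0 y `^ (1 - u))%:E * (\int[nu]_(f in D) (g f * e (f, y))%:E) `^ u)
  <= (a + c `^ u)%:E * (\int[nu]_(f in D) (g f)%:E) `^ u.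
Proof.
move=> mp0 p00 ip0 me e0 mD mg g0 u01 c0 diam affin.
have /andP[u0 u1] := u01; have un0 : (u != 0)%R by rewrite gt_eqF.
have me1 y : measurable_fun setT (fun f => e (f, y)).
  by apply: (measurableT_comp me); exact: pair2_measurable.
have me2 f : measurable_fun setT (fun y => e (f, y)).
  by apply: (measurableT_comp me); exact: pair1_measurable.
(* The comparison density [q] has to come from [D], so the empty piece is treated apart. *)
have [->|/set0P[q Dq]] := eqVneq D set0.
  rewrite integral_set0 poweR0r// mule0 integral0_eq// => y _.
  by rewrite integral_set0 poweR0r// mule0.
have a0 : (0 <= a)%R.
  rewrite -lee_fin; apply: le_trans (affin q Dq); apply: integral_ge0 => y _.
  by rewrite lee_fin mulr_ge0 ?powR_ge0.
set G := \int[nu]_(f in D) (g f)%:E.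
have G0 : 0 <= G by apply: integral_ge0 => f _; rewrite lee_fin.
have ac0 : (0 < a + c `^ u)%R by rewrite ltr_wpDl// powR_gt0.
have [Goo|] := eqVneq G +oo.
  by rewrite Goo poweRyr// gt0_muley ?lte_fin// leey.
rewrite -ltey => Glty.
(* With mass 0 the product [c * k] below would vanish and could not serve as the scale in Young's
   inequality. *)
have [G00|Gn0] := eqVneq G 0.
  rewrite G00 poweR0r// mule0 integral0_eq// => y _.
  by rewrite integral_eq0_mul// poweR0r// mule0.
have Gfin : G \is a fin_num by rewrite ge0_fin_numE.
pose k := fine G; have GE : G = k%:E by rewrite /k fineK.
have k0 : (0 < k)%R by rewrite -lte_fin -GE lt0e Gn0.
have ck0 : (0 < c * k)%R by rewrite mulr_gt0.
pose h (z : F * Y) := (g z.1 * `|e z - e (q, z.2)|)%:E.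
have mh : measurable_fun [set: F * Y] h.
  apply/measurable_EFinP; apply: measurable_funM; first exact: measurableT_comp.
  apply: measurableT_comp => //; apply: measurable_funB => //.
  exact: (measurableT_comp (me2 q)).
have h0 z : 0 <= h z by rewrite lee_fin mulr_ge0.
pose E y := \int[nu]_(f in D) h (f, y).
have mE : measurable_fun setT E by exact: measurable_integral_section.
have E0 y : 0 <= E y by exact: integral_ge0.
have mgE : measurable_fun setT (EFin \o g) by exact/measurable_EFinP.
have gE0 f : 0 <= (EFin \o g) f by rewrite lee_fin.
have mdiff : measurable_fun [set: F * Y] (fun z => (`|e z - e (q, z.2)|)%:E).
  apply/measurable_EFinP; apply: measurableT_comp => //.
  apply: measurable_funB => //; exact: (measurableT_comp (me2 q)).
have diff0 (z : F * Y) : 0 <= (`|e z - e (q, z.2)|)%:E by rewrite lee_fin.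
have iE : \int[mu]_y E y <= (c * k)%:E.
  rewrite EFinM -GE.
  have := integral_kernel_le mD mdiff diff0 mgE gE0 (ltW c0) (fun f Df => diam f q Df Dq).
  by apply: le_trans.
have mixle y : \int[nu]_(f in D) (g f * e (f, y))%:E <= (k * e (q, y))%:E + E y.
  have mgD : measurable_fun D (EFin \o g).
    by apply/measurable_EFinP; exact: measurable_funTS.
  have mgq : measurable_fun D (fun f => (e (q, y))%:E * (g f)%:E).
    exact: measurable_funeM.
  have mhy : measurable_fun D (fun f => h (f, y)).
    apply: measurable_funTS; apply: (measurableT_comp mh); exact: pair2_measurable.
  have gq0 f : D f -> 0 <= (e (q, y))%:E * (g f)%:E by rewrite mule_ge0 ?lee_fin.
  have g0' f : D f -> 0 <= (g f)%:E by rewrite lee_fin.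
  have hy0 f : D f -> 0 <= h (f, y) by [].
  rewrite [(k * _)%R]mulrC EFinM -GE -ge0_integralZl_EFin// -ge0_integralD//.
  apply: ge0_le_integral => //.
  - by move=> f _; rewrite lee_fin mulr_ge0.
  - by apply/measurable_EFinP; apply: measurable_funTS; exact: measurable_funM.
  - exact: emeasurable_funD.
  - move=> f _; rewrite /h /= -EFinM -EFinD lee_fin [(e (q, y) * _)%R]mulrC.
    by rewrite -mulrDr ler_wpM2l// -lerBlDl ler_norm.
(* The power [u] is subadditive: the part [k * e (q, y)] yields the affinity with [p0], and [E y]
   goes through Young's inequality at scale [c * k], which bounds the integral of [E]. *)
apply: (@le_trans _ _ (\int[mu]_y ((k `^ u)%:E * (p0 y `^ (1 - u) * e (q, y) `^ u)%:E
   + ((c * k) `^ u)%:E * (((1 - u) * p0 y)%:E + (u / (c * k))%:E * E y)))).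
  apply: le_integralT_nonmeasurable => y.
    by rewrite mule_ge0 ?poweR_ge0 ?lee_fin ?powR_ge0.
  have mix0 : 0 <= \int[nu]_(f in D) (g f * e (f, y))%:E.
    by apply: integral_ge0 => f _; rewrite lee_fin mulr_ge0.
  apply: (@le_trans _ _ ((p0 y `^ (1 - u))%:E *
      ((k * e (q, y))%:E `^ u + E y `^ u))).
    rewrite lee_wpmul2l ?lee_fin ?powR_ge0//.
    apply: le_trans (le_poweR (ltW u0) mix0 (mixle y)) _.
    by apply: poweRD_le => //; rewrite lee_fin mulr_ge0// ltW.
  rewrite ge0_muleDr ?poweR_ge0//; apply: leeD; last exact: young_poweR_scaled.
  rewrite poweR_EFin -!EFinM lee_fin powRM ?(ltW k0)//.
  by rewrite mulrCA.
have mp1 : measurable_fun setT (fun y => (p0 y `^ (1 - u) * e (q, y) `^ u)%R).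
  by apply: measurable_funM; apply: (measurableT_comp (measurable_powR _)).
have mp2 : measurable_fun setT (fun y => ((1 - u) * p0 y)%:E).
  by apply/measurable_EFinP; exact: measurable_funM.
have mp3 : measurable_fun setT (fun y => (p0 y)%:E) by exact/measurable_EFinP.
have mp4 : measurable_fun setT (fun y => (p0 y `^ (1 - u) * e (q, y) `^ u)%:E).
  exact/measurable_EFinP.
have uck0 : (0 <= u / (c * k))%R by rewrite divr_ge0// ltW.
have u10 : (0 <= 1 - u)%R by rewrite subr_ge0 ltW.
have mp5 : measurable_fun setT (fun y => (u / (c * k))%:E * E y).
  exact: measurable_funeM.
have mp6 := emeasurable_funD mp2 mp5.
have nn1 y : 0 <= (p0 y `^ (1 - u) * e (q, y) `^ u)%:E.
  by rewrite lee_fin mulr_ge0 ?powR_ge0.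
have nn2 y : 0 <= ((1 - u) * p0 y)%:E by rewrite lee_fin mulr_ge0.
have nn3 y : 0 <= (u / (c * k))%:E * E y by rewrite mule_ge0.
have nn4 y : 0 <= ((1 - u) * p0 y)%:E + (u / (c * k))%:E * E y by rewrite adde_ge0.
have nn5 y : 0 <= (p0 y)%:E by rewrite lee_fin.
rewrite ge0_integralD//; last 4 first.
- by move=> y _; rewrite mule_ge0// lee_fin powR_ge0.
- exact: measurable_funeM.
- by move=> y _; rewrite mule_ge0// lee_fin powR_ge0.
- exact: measurable_funeM.
rewrite [X in X + _]ge0_integralZl_EFin ?powR_ge0//.
rewrite [X in _ + X]ge0_integralZl_EFin ?powR_ge0//.
rewrite [X in _ + _ * X]ge0_integralD//.
rewrite [X in _ + _ * (_ + X)]ge0_integralZl_EFin//.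
have -> : \int[mu]_y ((1 - u) * p0 y)%:E = (1 - u)%:E.
  by under eq_integral do rewrite EFinM; rewrite ge0_integralZl_EFin// ip0 mule1.
rewrite GE poweR_EFin (EFinD a) ge0_muleDl ?lee_fin ?powR_ge0//; apply: leeD.
  by rewrite [leRHS]muleC lee_wpmul2l ?lee_fin ?powR_ge0// affin.
rewrite -[leRHS]EFinM -powRM ?(ltW c0) ?(ltW k0)//.
rewrite -[leRHS]mule1 lee_wpmul2l ?lee_fin ?powR_ge0//.
(* At this scale the two terms of Young's inequality contribute [1 - u] and at most [u], which add
   up to 1. *)
apply: (@le_trans _ _ ((1 - u)%:E + (u / (c * k))%:E * (c * k)%:E)).
  by rewrite leeD2l// lee_wpmul2l// lee_fin divr_ge0// ltW.
by rewrite -EFinM -EFinD divfK ?gt_eqF// subrK.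
Qed.

End one_observation.

(** * n observations *)

Section n_observations.
Context (dF dY : measure_display) (F : measurableType dF) (Y : measurableType dY).
Context (R : realType).
Variables (nu : {sigma_finite_measure set F -> \bar R}).
Variables (mu : {sigma_finite_measure set Y -> \bar R}).
Variables (p0 : Y -> R) (e : F * Y -> R) (phi : F * Y -> \bar R).
Variables (D : nat -> set F) (K : set F) (u gam bet : R).

Definition sample_likelihood f s : R := likelihood (fun y => e (f, y)) s.

Definition sample_kernel f s : \bar R := \big[*%E/1]_(y <- s) phi (f, y).

(* The last argument is the remaining sample; [g], [h] and [a] absorb the factors
   contributed by the observations already integrated out. *)
Definition dominating a (g : F -> R) (h : F -> \bar R) s : \bar R :=
  \sum_(i <oo) ((a * likelihood p0 s `^ (1 - u))%:E *
    (\int[nu]_(f in D i) (g f * sample_likelihood f s)%:E) `^ u) +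
  \int[nu]_(f in K) (h f * sample_kernel f s).

Hypotheses (mp0 : measurable_fun setT p0) (p00 : forall y, (0 <= p0 y)%R).
Hypotheses (me : measurable_fun [set: F * Y] e) (e0 : forall z, (0 <= e z)%R).
Hypotheses (mphi : measurable_fun [set: F * Y] phi) (phi0 : forall z, 0 <= phi z).
Hypotheses (mD : forall i, measurable (D i)) (mK : measurable K).
Hypotheses (gam0 : (0 <= gam)%R) (bet0 : (0 <= bet)%R).
Hypothesis step_D : forall i (g : F -> R), measurable_fun setT g ->
  (forall f, 0 <= g f)%R ->
  \int[mu]_y ((p0 y `^ (1 - u))%:E *
    (\int[nu]_(f in D i) (g f * e (f, y))%:E) `^ u) <=
  gam%:E * (\int[nu]_(f in D i) (g f)%:E) `^ u.
Hypothesis step_K : forall h : F -> \bar R, measurable_fun setT h ->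
  (forall f, 0 <= h f) ->
  \int[mu]_y \int[nu]_(f in K) (h f * phi (f, y)) <=
  bet%:E * \int[nu]_(f in K) h f.

Lemma sample_likelihood_ge0 f s : (0 <= sample_likelihood f s)%R.
Proof. by apply: prodr_ge0. Qed.

Lemma sample_kernel_ge0 f s : 0 <= sample_kernel f s.
Proof.
rewrite /sample_kernel; elim: s => [|y s IH]; first by rewrite big_nil.
by rewrite big_cons mule_ge0.
Qed.

Lemma likelihood_p0_ge0 s : (0 <= likelihood p0 s)%R.
Proof. by apply: prodr_ge0. Qed.

Lemma dominating_ge0 a g (h : F -> \bar R) s : (0 <= a)%R -> (forall f, 0 <= h f) ->
  0 <= dominating a g h s.
Proof.
move=> a0 h0; apply: adde_ge0.
  apply: nneseries_ge0 => i _ _.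
  by rewrite mule_ge0 ?poweR_ge0 ?lee_fin ?mulr_ge0 ?powR_ge0.
by apply: integral_ge0 => f _; rewrite mule_ge0 ?sample_kernel_ge0.
Qed.

Lemma dominating_cons a g h y s : dominating a g h (y :: s) =
  dominating (a * p0 y `^ (1 - u)) (fun f => g f * e (f, y))%R
             (fun f => h f * phi (f, y)) s.
Proof.
rewrite /dominating; apply: congr2.
  apply: eq_eseriesr => i _; congr (_ * _ `^ _).
    by rewrite /likelihood big_cons powRM ?prodr_ge0// mulrA.
  apply: eq_integral => f _.
  by rewrite /sample_likelihood /likelihood big_cons mulrA.
by apply: eq_integral => f _; rewrite /sample_kernel big_cons muleA.
Qed.

(** Induction on [n] with all weights general: the first observation is absorbed by the weights, the
    induction hypothesis treats the others, and [step_D] and [step_K] then integrate it out at the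
    cost of one factor [gam] or [bet]. *)
Lemma iterated_integral_dominating_le n a (g : F -> R) (h : F -> \bar R) : (0 <= a)%R ->
  measurable_fun setT g -> (forall f, 0 <= g f)%R ->
  measurable_fun setT h -> (forall f, 0 <= h f) ->
  iterated_integral mu n (dominating a g h) <=
  (gam ^+ n)%:E * \sum_(i <oo) (a%:E * (\int[nu]_(f in D i) (g f)%:E) `^ u) +
  (bet ^+ n)%:E * \int[nu]_(f in K) h f.
Proof.
elim: n a g h => [|n IH] a g h a0 mg g0 mh h0 /=.
  rewrite !expr0 !mul1e /dominating; apply: leeD.
    rewrite le_eqVlt; apply/orP; left; apply/eqP.
    apply: eq_eseriesr => i _; rewrite /likelihood big_nil powR1 mulr1.
    congr (_ * _ `^ _); apply: eq_integral => f _.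
    by rewrite /sample_likelihood /likelihood big_nil mulr1.
  rewrite le_eqVlt; apply/orP; left; apply/eqP.
  by apply: eq_integral => f _; rewrite /sample_kernel big_nil mule1.
have me1 y : measurable_fun setT (fun f => e (f, y)).
  by apply: (measurableT_comp me); exact: pair2_measurable.
have mphi1 y : measurable_fun setT (fun f => phi (f, y)).
  by apply: (measurableT_comp mphi); exact: pair2_measurable.
have mge : measurable_fun [set: F * Y] (fun z => (g z.1 * e z)%:E).
  by apply/measurable_EFinP; apply: measurable_funM => //; exact: measurableT_comp.
have mhphi : measurable_fun [set: F * Y] (fun z => h z.1 * phi z).
  by apply: emeasurable_funM => //; exact: measurableT_comp.
have ge0 (z : F * Y) : 0 <= (g z.1 * e z)%:E by rewrite lee_fin mulr_ge0.
have hphi0 (z : F * Y) : 0 <= h z.1 * phi z by rewrite mule_ge0.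
pose I i y := \int[nu]_(f in D i) (g f * e (f, y))%:E.
have mI i : measurable_fun setT (I i).
  exact: (measurable_integral_section nu (mD i) mge ge0).
have mJ : measurable_fun setT (fun y => \int[nu]_(f in K) (h f * phi (f, y))).
  exact: (measurable_integral_section nu mK mhphi hphi0).
have J0 y : 0 <= \int[nu]_(f in K) (h f * phi (f, y)).
  by apply: integral_ge0 => f _; rewrite mule_ge0.
have ap0 y : (0 <= a * p0 y `^ (1 - u))%R by rewrite mulr_ge0 ?powR_ge0.
pose V i y := (a * p0 y `^ (1 - u))%:E * (I i y) `^ u.
have V0 i y : 0 <= V i y by rewrite mule_ge0 ?lee_fin ?poweR_ge0.
have mp : measurable_fun setT (fun y => p0 y `^ (1 - u))%R.
  exact: (measurableT_comp (measurable_powR _)).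
have mIu i : measurable_fun setT (fun y => I i y `^ u).
  exact: (measurableT_comp (measurable_poweR _)).
have mV i : measurable_fun setT (V i).
  apply: emeasurable_funM => //.
  by apply/measurable_EFinP; exact: measurable_funM.
have mSV : measurable_fun setT (fun y => \sum_(i <oo) V i y).
  exact: ge0_emeasurable_sum.
have SV0 y : 0 <= \sum_(i <oo) V i y by exact: nneseries_ge0.
(* The induction hypothesis is applied for each fixed [y]; only the majorant has to be measurable in
   [y]. *)
apply: (@le_trans _ _ (\int[mu]_y ((gam ^+ n)%:E * (\sum_(i <oo) V i y) +
    (bet ^+ n)%:E * \int[nu]_(f in K) (h f * phi (f, y))))).
  apply: le_integralT_nonmeasurable => y.
    by apply: iterated_integral_ge0 => s; exact: dominating_ge0.
  rewrite (_ : (fun s => _) = dominating (a * p0 y `^ (1 - u))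
    (fun f => g f * e (f, y))%R (fun f => h f * phi (f, y))); last first.
    by apply/funext => s; rewrite dominating_cons.
  apply: IH => //.
  - exact: measurable_funM.
  - by move=> f; rewrite mulr_ge0.
  - exact: emeasurable_funM.
  - by move=> f; rewrite mule_ge0.
have gn0 : (0 <= gam ^+ n)%R by exact: exprn_ge0.
have bn0 : (0 <= bet ^+ n)%R by exact: exprn_ge0.
have mT1 : measurable_fun setT (fun y => (gam ^+ n)%:E * \sum_(i <oo) V i y).
  exact: measurable_funeM.
have mT2 : measurable_fun setT
    (fun y => (bet ^+ n)%:E * \int[nu]_(f in K) (h f * phi (f, y))).
  exact: measurable_funeM.
have T10 y : 0 <= (gam ^+ n)%:E * \sum_(i <oo) V i y by rewrite mule_ge0.
have T20 y : 0 <= (bet ^+ n)%:E * \int[nu]_(f in K) (h f * phi (f, y)).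
  by rewrite mule_ge0.
rewrite ge0_integralD//; apply: leeD; last first.
  rewrite ge0_integralZl_EFin// exprSr EFinM -muleA lee_wpmul2l//.
  exact: step_K.
rewrite ge0_integralZl_EFin// exprSr EFinM -muleA lee_wpmul2l//.
rewrite integral_nneseries// -nneseriesZl; last first.
  by move=> i _; rewrite mule_ge0 ?poweR_ge0.
apply: lee_nneseries => [i _ _|i _]; first exact: integral_ge0.
rewrite muleCA.
under eq_integral do rewrite /V EFinM -muleA.
rewrite ge0_integralZl_EFin//.
- by rewrite lee_wpmul2l// step_D.
- by move=> y _; rewrite mule_ge0 ?lee_fin ?powR_ge0 ?poweR_ge0.
- by apply: emeasurable_funM => //; exact/measurable_EFinP.
Qed.

End n_observations.

(** * Pointwise domination of the posterior mass *)

Section divergence_kernel.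
Context (dF dY : measure_display) (F : measurableType dF) (Y : measurableType dY).
Context (R : realType).
Variables (p0 : Y -> R) (e : F * Y -> R) (t : R).
Hypotheses (mp0 : measurable_fun setT p0) (p00 : forall y, (0 <= p0 y)%R).
Hypotheses (me : measurable_fun [set: F * Y] e) (e0 : forall z, (0 <= e z)%R).
Hypothesis t0 : (0 < t)%R.

(* For [e z = f y], its integral in [y] is [1 + t * d_t^2(p0, f)]; the value at
   [e z = 0] relies on [0^-1 = +oo] in [\bar R] and on [0 * +oo = 0]. *)
Definition power_kernel (z : F * Y) : \bar R :=
  (p0 z.2 `^ (1 + t))%:E * ((e z `^ t)%:E)^-1.

Lemma power_kernel_ge0 z : 0 <= power_kernel z.
Proof. by rewrite mule_ge0 ?inve_ge0 ?lee_fin ?powR_ge0. Qed.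

Lemma measurable_inve_powR : measurable_fun [set: R] (fun r : R => ((r `^ t)%:E)^-1).
Proof.
have -> : (fun r : R => ((r `^ t)%:E)^-1) =
    (fun r => if r == 0%R then +oo else (r `^ (- t))%:E).
  by apply/funext => r; rewrite inver powR_eq0 (gt_eqF t0) andbT powRN.
apply: measurable_fun_ifT => //.
- exact: measurable_fun_eqr.
- by apply/measurable_EFinP; exact: measurable_powR.
Qed.

Lemma measurable_power_kernel : measurable_fun [set: F * Y] power_kernel.
Proof.
apply: emeasurable_funM.
  apply/measurable_EFinP; apply: (measurableT_comp (measurable_powR _)).
  exact: measurableT_comp.
exact: (measurableT_comp measurable_inve_powR).
Qed.

(** Multiplicativity survives a vanishing factor: the inverse of a finite power is never 0, so no
    product of 0 and [+oo] arises. *)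
Lemma inveM_powR a b : (0 <= a)%R -> (0 <= b)%R ->
  (((a * b) `^ t)%:E)^-1 = ((a `^ t)%:E)^-1 * ((b `^ t)%:E)^-1 :> \bar R.
Proof.
move=> a0 b0; rewrite powRM// !inver mulf_eq0.
have h (c : R) : (0 <= c)%R -> (c != 0)%R -> 0 < (c^-1)%:E.
  by move=> c0 cn0; rewrite lte_fin invr_gt0 lt0r cn0.
case: eqVneq => [_|an0]; case: eqVneq => [_|bn0] //=.
- by rewrite gt0_mulye// h// powR_ge0.
- by rewrite gt0_muley// h// powR_ge0.
- by rewrite invfM EFinM.
Qed.

Lemma sample_kernelE f s : sample_kernel power_kernel f s =
  (likelihood p0 s `^ (1 + t))%:E * ((sample_likelihood e f s `^ t)%:E)^-1.
Proof.
elim: s => [|y s IH].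
  rewrite /sample_kernel /sample_likelihood /likelihood !big_nil !powR1.
  by rewrite inve1 mule1.
rewrite /sample_kernel big_cons -/(sample_kernel _ _ _) IH.
rewrite /sample_likelihood /likelihood !big_cons inveM_powR ?prodr_ge0//.
by rewrite powRM ?prodr_ge0// EFinM /power_kernel muleACA.
Qed.

Lemma measurable_sample_likelihood s :
  measurable_fun [set: F] (fun f => sample_likelihood e f s).
Proof.
elim: s => [|y s IH].
  under eq_fun do rewrite /sample_likelihood /likelihood big_nil.
  exact: measurable_cst.
rewrite (_ : (fun _ => _) = (fun f => e (f, y) * sample_likelihood e f s)%R).
  apply: measurable_funM => //.
  by apply: (measurableT_comp me); exact: pair2_measurable.
by apply/funext => f; rewrite /sample_likelihood /likelihood big_cons.
Qed.

Lemma measurable_sample_kernel s :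
  measurable_fun [set: F] (fun f => sample_kernel power_kernel f s).
Proof.
under eq_fun do rewrite sample_kernelE.
apply: measurable_funeM.
exact: (measurableT_comp measurable_inve_powR (measurable_sample_likelihood s)).
Qed.

Section pointwise.
Variables (nu : probability F R).

Let Z (B : set F) s := \int[nu]_(f in B) (sample_likelihood e f s)%:E.

Let Z0 B s : 0 <= Z B s.
Proof. by apply: integral_ge0 => f _; rewrite lee_fin sample_likelihood_ge0. Qed.

Let mL B s : measurable_fun B (fun f => (sample_likelihood e f s)%:E).
Proof.
by apply/measurable_EFinP; apply: measurable_funTS; exact: measurable_sample_likelihood.
Qed.

Let leZ B C s : measurable B -> measurable C -> B `<=` C -> Z B s <= Z C s.
Proof.
move=> mB mC BC; apply: ge0_subset_integral => // f _.
by rewrite lee_fin sample_likelihood_ge0.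
Qed.

(** The sets may overlap: [seqDU] makes them disjoint, and each disjoint piece lies in the original
    one. *)
Lemma integral_bigcup_le (D : nat -> set F) s : (forall i, measurable (D i)) ->
  Z (\bigcup_i D i) s <= \sum_(i <oo) Z (D i) s.
Proof.
move=> mD; rewrite /Z seqDU_bigcup_eq ge0_integral_bigcup//.
- apply: lee_nneseries => [i _ _|i _]; first exact: Z0.
  by apply: leZ => //; [exact: seqDU_measurable|exact: subset_seqDU].
- exact: seqDU_measurable.
- by move=> f _; rewrite lee_fin sample_likelihood_ge0.
Qed.

(* Markov's inequality for [x `^ (- t)], where convexity enters only through the
   tangent line at [b]. *)
Lemma integral_sample_kernel_ge (K : set F) s (b k : R) : measurable K ->
  (0 < b)%R -> nu K = k%:E -> (0 < k)%R -> (0 < likelihood p0 s)%R ->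
  Z K s <= (b * k * likelihood p0 s)%:E ->
  (likelihood p0 s)%:E <=
  \int[nu]_(f in K) ((b `^ t / k)%:E * sample_kernel power_kernel f s).
Proof.
move=> mK b0 nuK k0 L0 ZK.
set L := likelihood p0 s in L0 ZK *.
have bt0 : (0 < b `^ t)%R by exact: powR_gt0.
have mS : measurable_fun K (fun f => sample_kernel power_kernel f s).
  by apply: measurable_funTS; exact: measurable_sample_kernel.
have S0 f : 0 <= sample_kernel power_kernel f s.
  by apply: sample_kernel_ge0; exact: power_kernel_ge0.
rewrite ge0_integralZl_EFin//; last by rewrite divr_ge0// ltW.
(* Coefficient of the likelihood in [powRN_tangent_scaled]. *)
set c := (t * (b `^ t)^-1 * b^-1)%R.
have c0 : (0 <= c)%R by rewrite !mulr_ge0 ?invr_ge0// ltW.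
have key : ((1 + t) * (b `^ t)^-1 * L * k)%:E <=
    \int[nu]_(f in K) sample_kernel power_kernel f s + c%:E * Z K s.
  rewrite (EFinM _ k) -nuK -integral_cst//.
  rewrite -ge0_integralZl_EFin//; last first.
    by move=> f _; rewrite lee_fin sample_likelihood_ge0.
  rewrite -ge0_integralD//; last 2 first.
  - by move=> f _; rewrite mule_ge0 ?lee_fin ?sample_likelihood_ge0.
  - exact: measurable_funeM.
  apply: ge0_le_integral => //.
  - by move=> f _; rewrite lee_fin !mulr_ge0 ?invr_ge0 ?addr_ge0// ltW.
  - by apply: emeasurable_funD => //; exact: measurable_funeM.
  - move=> f _ /=; rewrite sample_kernelE -/L.
    have := sample_likelihood_ge0 e0 f s.
    rewrite le_eqVlt => /orP[/eqP <-|l0].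
      (* A vanishing likelihood makes the kernel [+oo], because [L] is positive. *)
      rewrite powR0 ?gt_eqF// inve0 gt0_muley ?lte_fin ?powR_gt0//.
      by rewrite mule0 adde0 leey.
    rewrite inver gt_eqF ?powR_gt0// -!EFinM -EFinD lee_fin.
    exact: powRN_tangent_scaled.
move: key ZK; have := Z0 K s.
have : 0 <= \int[nu]_(f in K) sample_kernel power_kernel f s.
  exact: integral_ge0.
case: (\int[nu]_(f in K) sample_kernel power_kernel f s) => [x| |]//; last first.
  by move=> *; rewrite gt0_muley ?leey// lte_fin divr_gt0.
case: (Z K s) => [z| |]//.
rewrite -EFinM -EFinD !lee_fin => x0 z0 key zle.
(* By the assumed bound on [Z K s] the linear term is at most [t * b^(-t) * L * k], so that
   [b^(-t) * L * k] of the left-hand side of [key] remains. *)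
have : (c * z <= c * (b * k * L))%R by rewrite ler_wpM2l.
have -> : (c * (b * k * L) = t * (b `^ t)^-1 * L * k)%R.
  by rewrite /c; field; rewrite !gt_eqF.
move=> h.
have xge : ((b `^ t)^-1 * L * k <= x)%R by lra.
have bk0 : (0 < b `^ t / k)%R by rewrite divr_gt0.
rewrite -(ler_pM2l bk0) in xge; apply: le_trans xge.
rewrite le_eqVlt; apply/orP; left; apply/eqP.
by field; rewrite !gt_eqF.
Qed.

(** Both terms of [dominating] are nonnegative, so it is enough that one of them dominates in each
    case, whether the integrated likelihood of [K] is large or small. No event in the sample space
    has to be measured. *)
Lemma posterior_mul_likelihood_le (S A K : set F) (D : nat -> set F) (u b k : R) s :
  measurable S -> measurable A -> measurable K -> (forall i, measurable (D i)) ->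
  A `<=` S -> K `<=` S -> A `<=` \bigcup_i D i ->
  (0 < u < 1)%R -> (0 < b)%R -> nu K = k%:E -> (0 < k)%R ->
  Z A s / Z S s * (likelihood p0 s)%:E <=
  dominating nu p0 e power_kernel D K u ((b * k) `^ (- u)) (fun=> 1%R)
    (fun=> (b `^ t / k)%:E) s.
Proof.
move=> mS mA mK mD AS KS AD u01 b0 nuK k0; have /andP[u0 u1] := u01.
have bk0 : (0 < b * k)%R by rewrite mulr_gt0.
have btk0 : (0 <= b `^ t / k)%R by rewrite divr_ge0 ?powR_ge0// ltW.
set L := likelihood p0 s.
have pk0 := power_kernel_ge0.
rewrite /dominating -/L.
set T1 := \sum_(i <oo) _; set T2 := \int[nu]_(f in K) _.
have T10 : 0 <= T1.
  by apply: nneseries_ge0 => i _ _; rewrite mule_ge0 ?poweR_ge0 ?lee_fin ?mulr_ge0 ?powR_ge0.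
have T20 : 0 <= T2.
  by apply: integral_ge0 => f _; rewrite mule_ge0 ?sample_kernel_ge0.
have : (0 <= L)%R by exact: likelihood_p0_ge0.
rewrite le_eqVlt => /orP[/eqP <-|L0]; first by rewrite mule0 adde_ge0.
have ZAS := leZ s mA mS AS; have ZKS := leZ s mK mS KS.
have ZAD : Z A s `^ u <= \sum_(i <oo) Z (D i) s `^ u.
  apply: le_trans (poweR_nneseries_le u01 (fun i => Z0 (D i) s)).
  apply: le_poweR; rewrite ?(ltW u0)//.
  apply: le_trans (integral_bigcup_le s mD); apply: leZ => //.
  exact: bigcup_measurable.
have T1E : T1 = ((b * k) `^ (- u) * L `^ (1 - u))%:E * \sum_(i <oo) Z (D i) s `^ u.
  rewrite -nneseriesZl; last by move=> i _; exact: poweR_ge0.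
  apply: eq_eseriesr => i _; congr (_ * _ `^ _).
  by apply: eq_integral => f _; rewrite mul1r.
(* Degenerate denominators: if [Z S s = 0] the numerator vanishes as well, and if [Z S s = +oo] the
   quotient is 0. *)
have [ZS0|ZSn0] := eqVneq (Z S s) 0.
  have -> : Z A s = 0 by apply/eqP; rewrite eq_le Z0 -ZS0 ZAS.
  by rewrite mul0e mul0e adde_ge0.
have [ZSoo|ZSnoo] := eqVneq (Z S s) +oo.
  by rewrite ZSoo invey mule0 mul0e adde_ge0.
have ZSfin : Z S s \is a fin_num by rewrite ge0_fin_numE// ltey.
have ZAfin : Z A s \is a fin_num.
  by rewrite ge0_fin_numE//; apply: le_lt_trans ZAS _; rewrite ltey.
move: ZAS ZKS ZSn0 ZAD (Z0 A s) (Z0 S s).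
rewrite -(fineK ZSfin) -(fineK ZAfin); set a := fine (Z A s); set z := fine (Z S s).
rewrite !lee_fin eqe poweR_EFin => az ZKz zn0 aD a0 z0.
have zgt0 : (0 < z)%R by rewrite lt_def zn0.
rewrite inver (negbTE zn0) -!EFinM.
have r0 : (0 <= a / z)%R by rewrite divr_ge0.
have r1 : (a / z <= 1)%R by rewrite ler_pdivrMr// mul1r.
have [ZKL|ZKL] := leP (Z K s) (b * k * L)%:E.
  apply: (@le_trans _ _ L%:E); first by rewrite lee_fin ger_pMl.
  apply: (@le_trans _ _ T2); last by rewrite leeDr.
  exact: integral_sample_kernel_ge.
apply: (@le_trans _ _ T1); last by rewrite leeDl.
rewrite T1E; apply: (@le_trans _ _ (((b * k) `^ (- u) * L `^ (1 - u))%:E * (a `^ u)%:E)).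
  have bkLz : (b * k * L <= z)%R by rewrite -lee_fin (le_trans (ltW ZKL)).
  rewrite -EFinM lee_fin.
  have [->|an0] := eqVneq a 0%R.
    by rewrite !mul0r mulr_ge0 ?mulr_ge0 ?powR_ge0.
  have agt0 : (0 < a)%R by rewrite lt_def an0.
  have bkL0 : (0 < b * k * L)%R by rewrite mulr_gt0.
  (* A ratio of at most 1 does not decrease when raised to the power [u]; its denominator is then
     replaced by the smaller [b * k * L]. *)
  apply: (@le_trans _ _ ((a / z) `^ u * L)%R).
    by rewrite ler_pM2r// ger1_powR ?divr_gt0 ?r1// ltW.
  apply: (@le_trans _ _ ((a / (b * k * L)) `^ u * L)%R).
    rewrite ler_pM2r// ge0_ler_powR ?nnegrE ?divr_ge0 ?(ltW bkL0) ?(ltW u0)//.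
    by rewrite ler_pM2l// lef_pV2.
  have powV (v : R) : (0 < v)%R -> (v^-1 `^ u = v `^ (- u))%R.
    by move=> v0; rewrite -powR_inv1 ?ltW// -powRrM mulN1r.
  rewrite le_eqVlt; apply/orP; left; apply/eqP.
  rewrite (@powRM _ a) ?invr_ge0 ?(ltW bkL0)// powV// (powRM _ (ltW bk0) (ltW L0)).
  rewrite (addrC 1%R) (powRD (x := L)) ?(gt_eqF L0) ?implybT// powRr1 ?(ltW L0)//.
  by ring.
by rewrite lee_wpmul2l// lee_fin mulr_ge0 ?powR_ge0.
Qed.

End pointwise.
End divergence_kernel.

(** * Divergences and covers *)

Section divergence_integrals.
Context (d : measure_display) (Y : measurableType d) (R : realType).
Variables (mu : {measure set Y -> \bar R}).
Implicit Types (p q : Y -> R) (t u : R).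

(** The integral of [psi] may be infinite. The subtraction is still legitimate because the negative
    part of [phi] is at most [p], whose integral is 1. *)
Lemma integral_sub_density (phi psi : Y -> \bar R) p : is_density mu p ->
  measurable_fun setT psi -> (forall y, 0 <= psi y) ->
  (forall y, phi y = psi y - (p y)%:E) ->
  \int[mu]_y phi y = \int[mu]_y psi y - 1.
Proof.
move=> [mp p0 ip] mpsi psi0 phiE.
have mpE : measurable_fun setT (EFin \o p) by exact/measurable_EFinP.
have mphi : measurable_fun setT phi.
  by rewrite (_ : phi = psi \- (EFin \o p));
    [exact: emeasurable_funB|apply/funext => y; rewrite phiE].
have pE0 y : 0 <= (EFin \o p) y by rewrite lee_fin.
have mpos := measurable_funepos mphi; have mneg := measurable_funeneg mphi.
have neg_le y : phi^\- y <= (p y)%:E.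
  rewrite funenegE phiE ge_max lee_fin p0 andbT.
  case: (psi y) (psi0 y) => [r| |]//=; rewrite ?leNye// !lee_fin => r0.
  by rewrite opprB lerBlDr lerDl.
have ineg : \int[mu]_y phi^\- y <= 1.
  by rewrite -ip; apply: ge0_le_integral.
have negfin : \int[mu]_y phi^\- y \is a fin_num.
  rewrite ge0_fin_numE; first exact: le_lt_trans ineg (ltry _).
  exact: integral_ge0.
(* The relation [phi = psi - p], rearranged so that all terms are nonnegative. *)
have : \int[mu]_y (phi^\+ y + (EFin \o p) y) = \int[mu]_y (psi y + phi^\- y).
  apply: eq_integral => y _; rewrite funeposE funenegE phiE /=.
  case: (psi y) (psi0 y) => [r| |]// r0; last by rewrite /= ?maxye ?maxNye ?adde0 ?addye.
  have [h|h] := leP (r - p y)%R 0%R.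
    rewrite (max_idPr _) ?lee_fin// (max_idPl _) ?lee_fin ?oppr_ge0//.
    by rewrite add0e -EFinN -EFinD opprB subrKC.
  rewrite (max_idPl _) ?lee_fin ?(ltW h)// (max_idPr _) ?lee_fin ?oppr_le0 ?(ltW h)//.
  by rewrite adde0 -EFinD subrK.
rewrite ge0_integralD// ge0_integralD// ip => E.
rewrite integralE.
have -> : \int[mu]_y psi y = \int[mu]_y phi^\+ y + 1 - \int[mu]_y phi^\- y.
  by rewrite E addeK.
by rewrite [RHS]addeAC addeK.
Qed.

Lemma divergence_pos t p q : (0 < t)%R -> is_density mu p -> measurable_fun setT q ->
  (forall y, 0 <= q y)%R ->
  divergence mu t p q = (t^-1)%:E *
    (\int[mu]_y ((p y `^ (1 + t))%:E * ((q y `^ t)%:E)^-1) - 1).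
Proof.
move=> t0 dp mq q0; have [mp p0 ip] := dp.
congr (_ * _); apply: (integral_sub_density dp).
- apply: emeasurable_funM.
    by apply/measurable_EFinP; exact: (measurableT_comp (measurable_powR _)).
  exact: (measurableT_comp (measurable_inve_powR t0)).
- by move=> y; rewrite mule_ge0 ?inve_ge0 ?lee_fin ?powR_ge0.
- move=> y; rewrite /divergence_integrand t0.
  have t1 : (1 + t != 0)%R by rewrite gt_eqF ?addr_gt0.
  case: eqVneq => [->|pn0]; first by rewrite powR0// mul0e sube0.
  have pgt0 : (0 < p y)%R by rewrite lt_def pn0 p0.
  case: eqVneq => [->|qn0].
    rewrite powR0 ?gt_eqF// inve0 gt0_muley ?lte_fin ?powR_gt0//.
  have qgt0 : (0 < q y)%R by rewrite lt_def qn0 q0.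
  rewrite inver gt_eqF ?powR_gt0// -EFinM -EFinB; congr EFin.
  rewrite powRM ?invr_ge0// -powR_inv1// -powRrM mulN1r powRN.
  rewrite powRD ?(gt_eqF pgt0) ?implybT// powRr1//.
  by rewrite mulrBr mulr1 mulrA.
Qed.

Lemma divergence_neg u p q : (0 < u < 1)%R -> is_density mu p ->
  measurable_fun setT q -> (forall y, 0 <= q y)%R ->
  divergence mu (- u) p q =
    ((- u)^-1)%:E * (\int[mu]_y (p y `^ (1 - u) * q y `^ u)%:E - 1).
Proof.
move=> /andP[u0 u1] dp mq q0; have [mp p0 ip] := dp.
have u10 : (0 < 1 - u)%R by rewrite subr_gt0.
congr (_ * _); apply: (integral_sub_density dp).
- apply/measurable_EFinP; apply: measurable_funM;
    exact: (measurableT_comp (measurable_powR _)).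
- by move=> y; rewrite lee_fin mulr_ge0 ?powR_ge0.
- move=> y; rewrite /divergence_integrand oppr_gt0 ltNge (ltW u0) /=.
  case: eqVneq => [->|pn0]; first by rewrite powR0 ?gt_eqF// mul0r sube0.
  have pgt0 : (0 < p y)%R by rewrite lt_def pn0 p0.
  case: eqVneq => [->|qn0].
    by rewrite powR0 ?gt_eqF// mulr0 add0e.
  have qgt0 : (0 < q y)%R by rewrite lt_def qn0 q0.
  rewrite -EFinB; congr EFin.
  rewrite powRM ?invr_ge0// -[((q y)^-1)%R]powR_inv1// -powRrM mulN1r opprK.
  rewrite powRD ?(gt_eqF pgt0) ?implybT// powRr1//.
  by rewrite mulrBr mulr1 mulrA.
Qed.

(** Follows from the power integral being nonnegative. The bound is crude, but it keeps suprema and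
    infima of divergences away from [-oo]. *)
Lemma divergence_ge t p q : (0 < t)%R -> is_density mu p -> is_density mu q ->
  (- t^-1)%:E <= divergence mu t p q.
Proof.
move=> t0 dp [mq q0 _]; rewrite divergence_pos//.
rewrite -[leLHS]mule1 EFinN mulNe -muleN lee_wpmul2l ?lee_fin ?invr_ge0 ?(ltW t0)//.
rewrite leeBrDr// [leLHS]addeC subee//; apply: integral_ge0 => y _.
by rewrite mule_ge0 ?inve_ge0 ?lee_fin ?powR_ge0.
Qed.

(** Uses [1 + t * v <= expR (t * v)]. The [n]-th power of this exponential will be cancelled exactly
    by the factor [expR (- (n * V))] of the threshold [b], raised to the power [t]. *)
Lemma divergence_le_integral t p q (v : R) : (0 < t)%R -> is_density mu p ->
  measurable_fun setT q -> (forall y, 0 <= q y)%R -> divergence mu t p q <= v%:E ->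
  \int[mu]_y ((p y `^ (1 + t))%:E * ((q y `^ t)%:E)^-1) <= (expR (t * v))%:E.
Proof.
move=> t0 dp mq q0; rewrite divergence_pos// lee_pdivrMl// leeBlDr// -EFinM.
move=> /le_trans; apply; rewrite -EFinD lee_fin addrC; exact: expR_ge1Dx.
Qed.

Lemma lt_divergence_integral u p q (c : R) : (0 < u < 1)%R -> is_density mu p ->
  measurable_fun setT q -> (forall y, 0 <= q y)%R ->
  c%:E < divergence mu (- u) p q ->
  \int[mu]_y (p y `^ (1 - u) * q y `^ u)%:E <= (1 - u * c)%:E.
Proof.
move=> u01 dp mq q0; have /andP[u0 u1] := u01; rewrite divergence_neg//.
have : 0 <= \int[mu]_y (p y `^ (1 - u) * q y `^ u)%:E.
  by apply: integral_ge0 => y _; rewrite lee_fin mulr_ge0 ?powR_ge0.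
case: (\int[mu]_y _) => [x| |]// x0.
  rewrite -EFinB -EFinM lte_fin lee_fin invrN mulNr -mulrN opprB => h.
  suff : (u * c < 1 - x)%R by lra.
  by rewrite -(ltr_pM2l u0) mulrA mulfV ?gt_eqF// mul1r in h.
(* An infinite integral would make the divergence [-oo], against the lower bound [c]. *)
by rewrite addye// invrN EFinN mulNe gt0_muley ?lte_fin ?invr_gt0.
Qed.

(** No density can violate an infinite bound; as soon as one violates it, the bound may be taken
    finite. *)
Lemma divergence_neg_lty u p q : (0 < u < 1)%R -> is_density mu p -> is_density mu q ->
  divergence mu (- u) p q < +oo.
Proof.
move=> u01 dp [mq q0 _]; have /andP[u0 u1] := u01; rewrite divergence_neg//.
have : 0 <= \int[mu]_y (p y `^ (1 - u) * q y `^ u)%:E.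
  by apply: integral_ge0 => y _; rewrite lee_fin mulr_ge0 ?powR_ge0.
case: (\int[mu]_y _) => [x| |]// x0; first by rewrite -EFinB -EFinM ltry.
by rewrite addye// invrN EFinN mulNe gt0_muley ?lte_fin ?invr_gt0.
Qed.

End divergence_integrals.

Section covers.
Context (d : measure_display) (Y : measurableType d) (R : realType).
Variables (mu : {measure set Y -> \bar R}).

(** The infimum of a nonempty set of natural numbers is attained. The centres become a sequence,
    filled up with the zero function beyond [k], so that their type does not depend on [k]. *)
Lemma covering_numberP r (S : set (Y -> R)) : covering_number mu r S < +oo ->
  exists k (c : nat -> Y -> R), [/\ covering_number mu r S = (k%:R)%:E,
    (forall j, (j < k)%N -> is_density mu (c j)) &
    (forall f, S f -> exists2 j, (j < k)%N & L1_ball mu (c j) r f)].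
Proof.
rewrite /covering_number.
set A := [set k : nat | exists2 c : 'I_k -> Y -> R, _ & _] => Alty.
have : exists k, `[< A k >].
  apply: contrapT => nA; move: Alty; suff -> : A = set0 by rewrite image_set0 ereal_inf0.
  by apply/seteqP; split => // k Ak; apply: nA; exists k; apply/asboolP.
move=> exA; case: (ex_minnP exA) => k /asboolP Ak mink.
have [c cd cS] := Ak.
exists k, (fun j => if insub j is Some i then c i else cst 0%R).
split=> [|j jk|f /cS[i _ fi]].
- apply/eqP; rewrite eq_le; apply/andP; split.
    by apply: ereal_inf_lbound; exists k.
  apply: le_ereal_inf_tmp => _ [l Al <-]; rewrite lee_fin ler_nat mink//.
  exact/asboolP.
- by rewrite insubT.
- by exists i => //; rewrite valK.
Qed.

End covers.

Lemma nneseries_pickle_inv (R : realType) (T : countType) (J : set T) (v : T -> \bar R)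
    (x : nat -> \bar R) : (forall z, 0 <= v z) ->
  (forall i, 0 <= x i) ->
  (forall i z, pickle_inv i = Some z -> J z -> x i <= v z) ->
  (forall i, (forall z, pickle_inv i = Some z -> ~ J z) -> x i = 0) ->
  \sum_(i <oo) x i <= \esum_(z in J) v z.
Proof.
move=> v0 x0 xv xn; rewrite nneseries_esumT//.
have -> : \esum_(i in [set: nat]) x i = \esum_(i in [set pickle z | z in J]) x i.
  rewrite [RHS]esum_mkcond; apply: eq_esum => i _; case: ifPn => // iJ.
  apply: xn => z iz Jz; move/negP: iJ; apply; rewrite inE; exists z => //.
  by have := @pickle_invK T i; rewrite iz.
rewrite esum_image; last by move=> a b _ _; exact: (pcan_inj pickleK_inv).
by apply: le_esum => z Jz; apply: xv => //; exact: pickleK_inv.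
Qed.

Lemma nneseries_inv_square_lty (R : realType) (C : R) : (0 <= C)%R ->
  \sum_(n <oo) ((C * (n.+1%:R ^- 2))%R)%:E < +oo :> \bar R.
Proof.
move=> C0; apply: (@le_lt_trans _ _ (C * 2)%:E); last exact: ltry.
have pos n : (0 <= (C * (n.+1%:R ^- 2)))%R.
  by rewrite mulr_ge0// invr_ge0 exprn_ge0.
apply: lime_le; first by apply: is_cvg_nneseries => n _ _; rewrite lee_fin.
apply: nearW => n; rewrite sumEFin lee_fin -mulr_sumr ler_wpM2l//.
(* The stronger bound [2 - 2 / (n + 1)] on the partial sums is the one that passes through the
   induction. *)
apply: (@le_trans _ _ (2 - 2 / n.+1%:R)%R); last by rewrite gerBl divr_ge0.
elim: n => [|n IH]; first by rewrite big_geq// divr1 subrr.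
rewrite big_nat_recr//=; apply: le_trans (lerD IH (lexx _)) _.
have n0 : (0 < n.+1%:R :> R)%R by rewrite ltr0n.
rewrite -[n.+2]addn1 natrD; set x := n.+1%:R in n0 *.
have x1 : (1 <= x)%R by rewrite /x ler1n.
rewrite -subr_ge0.
have -> : (2 - 2 / (x + 1) - (2 - 2 / x + x ^- 2) = (x - 1) / (x ^+ 2 * (x + 1)))%R.
  by field; rewrite ?gt_eqF// addr_gt0.
by rewrite divr_ge0 ?subr_ge0// mulr_ge0 ?exprn_ge0// ?addr_ge0// ltW.
Qed.

(** * The mixing prior *)

Section prior.
Context (d : measure_display) (Y : measurableType d) (R : realType).
Variable mu : {sigma_finite_measure set Y -> \bar R}.
Context (G : set (set (Y -> R))) (M : countType).
Local Notation F := (g_sigma_algebraType G).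
Variables (w : M -> R) (prm : M -> probability F R) (S : M -> set F).
Variable pr : probability F R.
Hypothesis prior : mixing_prior mu w prm S pr.
Implicit Types (A B K : set F) (u t r : R).

Let P : set F := \bigcup_m S m.

Lemma measurable_support : measurable P.
Proof.
apply: countable_bigcupT_measurable; first exact: countableP.
by move=> m; exact: (supports_measurable prior).
Qed.

Lemma support_density q : P q -> is_density mu q.
Proof. by move=> [m _ Sq]; exact: (supports_density prior Sq). Qed.

(* The evaluation map, extended by [0] outside the support, where nothing is
   known about its measurability. *)
Definition evaluation : F * Y -> R :=
  (fun z : F * Y => (z.1 : Y -> R) z.2) \_ (P `*` [set: Y]).

Lemma evaluationE (q : F) y : P q -> evaluation (q, y) = (q : Y -> R) y.
Proof. by move=> Pq; rewrite /evaluation patchE mem_set. Qed.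

Lemma evaluation_ge0 z : (0 <= evaluation z)%R.
Proof.
rewrite /evaluation patchE; case: ifPn => //; rewrite inE => -[/support_density].
by move=> [_ + _] _; apply.
Qed.

Lemma measurable_evaluation : measurable_fun [set: F * Y] evaluation.
Proof.
apply/(measurable_restrictT _ _).1; last exact: (evaluation_measurable prior).
by apply: measurableX => //; exact: measurable_support.
Qed.

Lemma integrated_likelihoodE A s : A `<=` P ->
  integrated_likelihood pr A s =
  \int[pr]_(f in A) (sample_likelihood evaluation f s)%:E.
Proof.
move=> AP; apply: eq_integral => f; rewrite inE => Af.
rewrite /sample_likelihood; congr (likelihood _ s)%:E.
by apply/funext => y; rewrite evaluationE//; exact: AP.
Qed.

(** The prior [prm m'] of any other model is carried by [S m'], which does not meet [B], so only one
    term of the mixture survives. *)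
Lemma mixture_on_model m B : measurable B -> B `<=` S m ->
  pr B = (w m)%:E * prm m B.
Proof.
move=> mB BS; rewrite (mixtureE prior mB).
have z m' : m' <> m -> prm m' B = 0.
  move=> m'm; apply/eqP; rewrite eq_le measure_ge0 andbT.
  have mS := supports_measurable prior m'.
  have : prm m' (~` S m') = 0.
    by rewrite probability_setC// (supports_full prior) subee.
  move=> <-; apply: le_measure; rewrite ?inE//; first exact: measurableC.
  move=> q /BS Sq Sq'; apply: m'm.
  by apply: (nonoverlapping prior) => //; exists q.
have -> : [set: M] = [set m] `|` [set~ m] by rewrite setUv.
rewrite (esumID [set m]); last first.
  by move=> i _; rewrite mule_ge0 ?lee_fin ?(weights_ge0 prior).
rewrite setIUl setIid setICl setU0 setIUl setICr set0U setIid.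
rewrite esum_set1 ?mule_ge0 ?lee_fin ?(weights_ge0 prior)//.
by rewrite esum1 ?adde0// => i /= im; rewrite z// mule0.
Qed.

Lemma mixture_on_model_le m B : measurable B -> B `<=` S m -> pr B <= (w m)%:E.
Proof.
move=> mB BS; rewrite (mixture_on_model mB BS) -[leRHS]mule1.
by rewrite lee_wpmul2l ?lee_fin ?(weights_ge0 prior)// probability_le1.
Qed.

(** By Tonelli's theorem, joint measurability of the evaluation makes the power integral a
    measurable function of the density; on the support the divergence is an affine function of
    it. *)
Lemma measurable_divergence_gt u p0 (c : \bar R) : (0 < u < 1)%R ->
  is_density mu p0 -> measurable [set q : F | P q /\ c < divergence mu (- u) p0 q].
Proof.
move=> u01 dp0; have [mp0 p00 ip0] := dp0.
pose psi (z : F * Y) := (p0 z.2 `^ (1 - u) * evaluation z `^ u)%:E.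
have mpsi : measurable_fun [set: F * Y] psi.
  apply/measurable_EFinP; apply: measurable_funM.
    by apply: (measurableT_comp (measurable_powR _)); exact: measurableT_comp.
  exact: (measurableT_comp (measurable_powR _) measurable_evaluation).
have psi0 z : 0 <= psi z by rewrite lee_fin mulr_ge0 ?powR_ge0.
have mPsi := @measurable_fun_fubini_tonelli_F _ _ _ _ _ mu psi mpsi psi0.
pose H q := ((- u)^-1)%:E * (fubini_F mu psi q - 1).
have mH : measurable_fun [set: F] H.
  by apply: measurable_funeM; exact: emeasurable_funB.
rewrite (_ : [set _ | _] = P `&` [set q | c < H q]).
  by apply: measurable_lte => //;
    [exact: measurable_support|exact: measurable_funTS].
have E q : P q -> divergence mu (- u) p0 q = H q.
  move=> Pq; have [mq q0 _] := support_density Pq.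
  rewrite (divergence_neg u01 dp0 mq q0).
  rewrite /H /fubini_F /psi /=.
  by under [in RHS]eq_integral do rewrite evaluationE//.
by apply/seteqP; split => q [Pq /= cq]; split => //=; move: cq; rewrite E.
Qed.

(** The same argument with the [L1] distance. The ball alone need not belong to the sigma-algebra,
    hence the intersection with [S m]. *)
Lemma measurable_model_ball m f r : is_density mu f ->
  measurable (S m `&` (L1_ball mu f r : set F)).
Proof.
move=> [mf f0 _].
pose psi (z : F * Y) := (`|f z.2 - evaluation z|%R)%:E.
have mpsi : measurable_fun [set: F * Y] psi.
  apply/measurable_EFinP; apply: measurableT_comp => //; apply: measurable_funB.
    exact: measurableT_comp.
  exact: measurable_evaluation.
have psi0 z : 0 <= psi z by rewrite lee_fin.
have mPsi := @measurable_fun_fubini_tonelli_F _ _ _ _ _ mu psi mpsi psi0.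
rewrite (_ : _ `&` _ = S m `&` [set q | fubini_F mu psi q <= r%:E]).
  apply: measurable_lee => //; last exact: measurable_funTS.
  exact: (supports_measurable prior).
have E q : S m q -> L1_dist mu f q = fubini_F mu psi q.
  move=> Sq; apply: eq_integral => y _; rewrite /psi evaluationE//; by exists m.
apply/seteqP; split => q [Sq].
  by move=> [_]; rewrite E.
move=> /= h; split => //; split; last by rewrite E.
exact: (supports_density prior Sq).
Qed.

End prior.

Lemma L1_ball_diameter (d : measure_display) (Y : measurableType d) (R : realType)
  (mu : {measure set Y -> \bar R}) (c f g : Y -> R) r : is_density mu c ->
  L1_ball mu c r f -> L1_ball mu c r g ->
  \int[mu]_y (`|f y - g y|%R)%:E <= (r + r)%:E.
Proof.
move=> [mc c0 _] [[mf f0 _] cf] [[mg g0 _] cg].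
have mabs (h k : Y -> R) : measurable_fun setT h -> measurable_fun setT k ->
    measurable_fun setT (fun y => (`|h y - k y|%R)%:E).
  move=> mh mk; apply/measurable_EFinP; apply: measurableT_comp => //.
  exact: measurable_funB.
apply: (@le_trans _ _ (L1_dist mu c f + L1_dist mu c g)); last by rewrite EFinD leeD.
have mcf := mabs _ _ mc mf; have mcg := mabs _ _ mc mg.
rewrite /L1_dist -ge0_integralD//.
apply: ge0_le_integral => //.
- exact: mabs.
- exact: emeasurable_funD.
- move=> y _; rewrite -EFinD lee_fin (distrC (c y)).
  by rewrite -[in leLHS](subrK (c y) (f y)) -addrA ler_normD.
Qed.

(** The pieces are [A] cut by a model and one of its covering balls. Their diameter is at most
    [2 * r], so one observation costs at most a factor [gam]; each has prior mass at most the weight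
    of its model, whence the sum [W]. *)
Lemma iterated_integral_posterior_le (d : measure_display) (Y : measurableType d)
  (R : realType) (mu : {sigma_finite_measure set Y -> \bar R})
  (G : set (set (Y -> R))) (M : countType) (w : M -> R)
  (prm : M -> probability (g_sigma_algebraType G) R)
  (S : M -> set (g_sigma_algebraType G))
  (pr : probability (g_sigma_algebraType G) R)
  (p0 : Y -> R) (A K : set (g_sigma_algebraType G)) (n : nat)
  (u t r a V k b gam W : R) (N : M -> nat) (c : M -> nat -> Y -> R) :
  mixing_prior mu w prm S pr -> is_density mu p0 ->
  measurable A -> A `<=` \bigcup_m S m ->
  measurable K -> K `<=` \bigcup_m S m ->
  (0 < u < 1)%R -> (0 < t)%R -> (0 < r)%R -> (0 < b)%R ->
  pr K = k%:E -> (0 < k)%R ->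
  (forall q, K q -> divergence mu t p0 q <= V%:E) ->
  (forall q : Y -> R, A q -> \int[mu]_y (p0 y `^ (1 - u) * q y `^ u)%:E <= a%:E) ->
  (a + (r + r) `^ u <= gam)%R -> (0 <= gam)%R ->
  (forall m j, (j < N m)%N -> is_density mu (c m j)) ->
  (forall m f, S m f -> exists2 j, (j < N m)%N & L1_ball mu (c m j) r f) ->
  \esum_(m in [set: M]) ((w m `^ u)%:E * (N m)%:R%:E) <= W%:E ->
  iterated_integral mu n (fun s =>
    posterior pr (\bigcup_m S m) A s * (likelihood p0 s)%:E) <=
  (gam ^+ n * ((b * k) `^ (- u) * W) + expR (t * V) ^+ n * b `^ t)%:E.
Proof.
move=> prior dp0 mA AP mK KP u01 t0 r0 b0 prK k0 KV Aa agam gam0 dc cover NW.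
have [mp0 p00 ip0] := dp0; have /andP[u0 u1] := u01.
set e := evaluation S; have me := measurable_evaluation prior.
have e0 := evaluation_ge0 prior.
have mP := measurable_support prior.
(* A pair [(m, j)] stands for ball [j] of model [m]; numbers that code no valid pair give an empty
   piece. *)
pose J (z : M * nat) := (z.2 < N z.1)%N.
pose D i : set (g_sigma_algebraType G) := if @pickle_inv (M * nat)%type i is Some z then
  if J z then A `&` (S z.1 `&` L1_ball mu (c z.1 z.2) r) else set0 else set0.
have mD i : measurable (D i).
  rewrite /D; case: pickle_inv => [z|//]; case: ifPn => // Jz.
  apply: measurableI => //; apply: (measurable_model_ball prior); exact: dc.
have DA i : D i `<=` A.
  by rewrite /D; case: pickle_inv => [z|]//; case: ifPn => // _ q [].
have AD : A `<=` \bigcup_i D i.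
  move=> q Aq; have [m _ Sq] := AP _ Aq; have [j jN cq] := cover _ _ Sq.
  by exists (pickle (m, j)) => //; rewrite /D pickleK_inv /J /= jN.
have rr0 : (0 < r + r)%R by rewrite addr_gt0.
have eE q y : (\bigcup_m S m) q -> e (q, y) = q y by exact: evaluationE.
have diam i f q : D i f -> D i q ->
    \int[mu]_y (`|e (f, y) - e (q, y)|%R)%:E <= (r + r)%:E.
  move=> Df Dq; have Pf := AP _ (DA _ _ Df); have Pq := AP _ (DA _ _ Dq).
  under eq_integral do rewrite !eE//.
  move: Df Dq; rewrite /D; case: pickle_inv => [z|]//; case: ifPn => // Jz.
  by move=> [_ [_ Bf]] [_ [_ Bq]]; exact: L1_ball_diameter (dc _ _ Jz) Bf Bq.
have step_D i (g : g_sigma_algebraType G -> R) : measurable_fun setT g ->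
    (forall f, 0 <= g f)%R ->
    \int[mu]_y ((p0 y `^ (1 - u))%:E *
      (\int[pr]_(f in D i) (g f * e (f, y))%:E) `^ u) <=
    gam%:E * (\int[pr]_(f in D i) (g f)%:E) `^ u.
  move=> mg g0.
  apply: (@le_trans _ _ ((a + (r + r) `^ u)%:E * (\int[pr]_(f in D i) (g f)%:E) `^ u)).
    apply: integral_mixture_poweR_le => //; first exact: diam.
    move=> q Dq; apply: le_trans (Aa q (DA _ _ Dq)).
    have Pq := AP _ (DA _ _ Dq).
    by under eq_integral do rewrite eE//.
  by rewrite lee_wpmul2r ?poweR_ge0// lee_fin.
have V0 : (0 <= expR (t * V))%R by exact: expR_ge0.
have step_K (h : g_sigma_algebraType G -> \bar R) : measurable_fun setT h ->
    (forall f, 0 <= h f) ->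
    \int[mu]_y \int[pr]_(f in K) (h f * power_kernel p0 e t (f, y)) <=
    (expR (t * V))%:E * \int[pr]_(f in K) h f.
  move=> mh h0; apply: integral_kernel_le => //.
  - exact: measurable_power_kernel.
  - by move=> z; exact: power_kernel_ge0.
  - move=> q Kq; have Pq := KP _ Kq; have [mq q0 _] := support_density prior Pq.
    apply: le_trans (divergence_le_integral t0 dp0 mq q0 (KV q Kq)).
    by rewrite /power_kernel /=; under eq_integral do rewrite eE//.
have bk0 : (0 < b * k)%R by rewrite mulr_gt0.
have btk0 : (0 <= b `^ t / k)%R by rewrite divr_ge0 ?powR_ge0// ltW.
apply: (@le_trans _ _ (iterated_integral mu n
    (dominating pr p0 e (power_kernel p0 e t) D K u ((b * k) `^ (- u))
       (fun=> 1%R) (fun=> (b `^ t / k)%:E)))).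
  apply: le_iterated_integral => s.
    rewrite mule_ge0 ?lee_fin ?likelihood_p0_ge0//.
    by rewrite mule_ge0 ?inve_ge0// !(@integrated_likelihoodE _ _ _ _ _ S)//;
      apply: integral_ge0 => f _; rewrite lee_fin sample_likelihood_ge0.
  rewrite /posterior !(@integrated_likelihoodE _ _ _ _ _ S)//.
  exact: posterior_mul_likelihood_le.
have mpk := measurable_power_kernel mp0 me t0.
have pk0 := power_kernel_ge0 p0 e t.
have one0 (f : g_sigma_algebraType G) : (0 <= (fun=> 1 : R) f)%R by [].
have cst0 (f : g_sigma_algebraType G) : 0 <= (fun=> (b `^ t / k)%:E) f by rewrite lee_fin.
have mone : measurable_fun [set: g_sigma_algebraType G] (fun=> 1%R : R).
  exact: measurable_cst.
have mcst : measurable_fun [set: g_sigma_algebraType G] (fun=> (b `^ t / k)%:E).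
  exact: measurable_cst.
have := iterated_integral_dominating_le mp0 p00 me e0 mpk pk0 mD mK gam0 V0
  step_D step_K n (powR_ge0 (b * k) (- u)) mone one0 mcst cst0.
move=> /le_trans; apply.
rewrite EFinD; apply: leeD; last first.
  rewrite [X in _ * X](_ : _ = (b `^ t)%:E) -?EFinM//.
  transitivity ((b `^ t / k)%:E * pr K); first exact: integral_cst.
  by rewrite prK -EFinM divfK// gt_eqF.
rewrite EFinM lee_wpmul2l ?lee_fin ?exprn_ge0//.
rewrite nneseriesZl; last by move=> i _; exact: poweR_ge0.
rewrite EFinM lee_wpmul2l ?lee_fin ?powR_ge0//.
apply: le_trans NW.
have DE i : \int[pr]_(f in D i) 1%:E = pr (D i).
  by rewrite -[RHS]mul1e; exact: integral_cst.
under eq_eseriesr do rewrite DE.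
have wu0 m : 0 <= (w m `^ u)%:E by rewrite lee_fin powR_ge0.
apply: (@le_trans _ _ (\esum_(z in [set z | J z]) (w z.1 `^ u)%:E)).
  apply: nneseries_pickle_inv => [z|i|i z iz Jz|i niz].
  - exact: wu0.
  - exact: poweR_ge0.
  - rewrite -poweR_EFin; apply: le_poweR; rewrite ?(ltW u0)//.
    apply: (mixture_on_model_le prior (mD i)).
    by rewrite /D iz; move: Jz; rewrite /= => -> q [_ []].
  - rewrite (_ : D i = set0) ?measure0 ?poweR0r ?gt_eqF//.
    rewrite /D; move: niz; case: pickle_inv => [z|//] niz.
    by case: ifPn => // Jz; case: (niz z).
rewrite (_ : [set z | J z] = [set: M] `*`` (fun m => `I_(N m))); last first.
  by apply/seteqP; split => -[m j] //= -[].
rewrite -(@esum_esum _ _ _ _ _ (fun m _ => (w m `^ u)%:E))//.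
apply: le_esum => m _.
rewrite esum_fset//.
rewrite -fsbig_ord /= sumEFin sumr_const card_ord -EFinM lee_fin mulr_natr.
exact: lexx.
Qed.

(** * Tail of the posterior *)

(** A comparison of exponents, with [l = ln n]: multiplied by [u], the factor [n^(2/u)] inside the
    logarithm gives [- 2 * l], the factor [n^(2/t)] compensates the [n^(-2/t)] of [b], and [W^(1/u)]
    cancels [W]. What remains is at most the constant [2^u + u]. *)
Lemma tail_constant_le (R : realType) (n : nat) (u t V k a W eps b : R) :
  (0 < n)%N -> (0 < u < 1)%R -> (0 < t)%R -> (0 < k)%R -> (0 < W)%R ->
  (V - n%:R^-1 * ln k <= a + n%:R^-1)%R ->
  (eps = a + n%:R^-1 * ln (n%:R `^ (2 * (u^-1 + t^-1)) * W `^ u^-1))%R ->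
  (b = expR (- (n%:R * V)) * n%:R `^ (- (2 / t)))%R ->
  (expR (- (u * eps) + 2 `^ u * n%:R^-1) ^+ n * ((b * k) `^ (- u) * W) +
   expR (t * V) ^+ n * b `^ t <= (expR (2 `^ u + u) + 1) * n%:R ^- 2)%R.
Proof.
move=> n0 /andP[u0 u1] t0 k0 W0 Vle epsD bD.
have n0R : (0 < n%:R :> R)%R by rewrite ltr0n.
pose l : R := ln n%:R.
have nE : n%:R = expR l :> R by rewrite /l lnK ?posrE.
have powE (x y : R) : (0 < x)%R -> (x `^ y = expR (y * ln x))%R.
  by move=> x0; rewrite /powR gt_eqF.
have bE : b = expR (- (n%:R * V) - 2 / t * l)%R.
  by rewrite bD powE// -expRD mulNr.
have lnb : ln b = (- (n%:R * V) - 2 / t * l)%R by rewrite bE expRK.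
have b0 : (0 < b)%R by rewrite bE expR_gt0.
have lnbk : ln (b * k) = (- (n%:R * V) - 2 / t * l + ln k)%R by rewrite lnM ?posrE// lnb.
have epsE : eps = (a + n%:R^-1 * (2 * (u^-1 + t^-1) * l + u^-1 * ln W))%R.
  by rewrite epsD lnM ?posrE ?powR_gt0// !ln_powR.
have n2E : (n%:R ^- 2 = expR (- (2 * l)) :> R)%R.
  by rewrite expRN -[2%R]/(2%:R) expRM_natl -nE.
rewrite mulrDl mul1r; apply: lerD.
  rewrite -expRM_natl (powE (b * k)%R) ?mulr_gt0// lnbk.
  rewrite -(lnK (_ : W \is Num.pos)) ?posrE// n2E -!expRD ler_expR.
  (* Near-optimality of [K], multiplied by [n]: the slack [1 / n] costs only the constant 1, hence
     the [u] in the exponent. *)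
  have nV : (n%:R * V - ln k <= n%:R * a + 1)%R.
    have := Vle; rewrite -(ler_pM2l n0R) mulrBr mulrDr mulfV ?gt_eqF//.
    by rewrite mulrA mulfV ?gt_eqF// mul1r.
  have -> : (n%:R * (- (u * eps) + 2 `^ u * n%:R^-1) =
     - (u * (n%:R * a)) - 2 * l - 2 * u / t * l - ln W + 2 `^ u)%R.
    by rewrite epsE; field; rewrite !gt_eqF.
  rewrite -(ler_pM2l u0) in nV.
  have -> : (- u * (- (n%:R * V) - 2 / t * l + ln k) =
     u * (n%:R * V - ln k) + 2 * u / t * l)%R by field; rewrite gt_eqF.
  by rewrite (mulrDr u (n%:R * a)%R) mulr1 in nV; lra.
(* In the second term [V] cancels and exactly [n^(-2)] is left. *)
rewrite -expRM_natl (powE b)// lnb -expRD n2E ler_expR.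
rewrite le_eqVlt; apply/orP; left; apply/eqP.
by field; rewrite gt_eqF.
Qed.

(** * Near-minimisers of the penalized divergence *)

Section penalized.
Context (d : measure_display) (Y : measurableType d) (R : realType).
Variable mu : {measure set Y -> \bar R}.
Context (G : set (set (Y -> R))).
Local Notation F := (g_sigma_algebraType G).
Variables (p0 : Y -> R) (t : R) (n : nat).
Hypotheses (dp0 : is_density mu p0) (t0 : (0 < t)%R).

Lemma sup_divergence_ge (K S : set F) : K !=set0 -> K `<=` S ->
  S `<=` is_density mu -> (- t^-1)%:E <= ereal_sup [set divergence mu t p0 q | q in K].
Proof.
move=> [q Kq] KS SD; apply: le_trans (ereal_sup_ubound _); last by exists q; [exact: Kq|].
by apply: divergence_ge => //; exact/SD/KS.
Qed.

Lemma penalty_ge0 (x : \bar R) : x <= 1 -> 0 <= - ((n%:R^-1)%:E * lne x).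
Proof. by move=> x1; rewrite oppe_ge0 mule_ge0_le0 ?lee_fin ?invr_ge0// lne_le0. Qed.

Lemma penalized_divergence_ge (nu : probability F R) (S : set F) :
  S `<=` is_density mu -> (- t^-1)%:E <= penalized_divergence mu n t p0 nu S.
Proof.
move=> SD; apply: le_ereal_inf_tmp => _ [K [mK K0 KS] <-].
rewrite -[leLHS]adde0; apply: leeD; first exact: sup_divergence_ge K0 KS SD.
by rewrite penalty_ge0// probability_le1.
Qed.

(** Take a set within [e] of the infimum. Its term being finite, it has positive prior mass, since a
    null set is penalized by [+oo], and a finite supremum [V]. *)
Lemma penalized_divergence_adherent (nu : probability F R) (S : set F) (a e : R) :
  (0 < n)%N -> S `<=` is_density mu -> (0 < e)%R ->
  penalized_divergence mu n t p0 nu S = a%:E ->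
  exists K V k, [/\ measurable K, K `<=` S, nu K = k%:E, (0 < k)%R &
    (forall q, K q -> divergence mu t p0 q <= V%:E) /\
    (V - n%:R^-1 * ln k <= a + e)%R].
Proof.
move=> n0 SD e0 aE.
have fin : penalized_divergence mu n t p0 nu S \is a fin_num by rewrite aE.
have [_ [K [mK K0 KS] <-]] := lb_ereal_inf_adherent e0 fin.
rewrite -/(penalized_divergence mu n t p0 nu S) aE.
have := sup_divergence_ge K0 KS SD.
have Kub q : K q -> divergence mu t p0 q <= ereal_sup [set divergence mu t p0 q | q in K].
  by move=> Kq; apply: ereal_sup_ubound; exists q.
move: Kub; case: (ereal_sup _) => [V| |]// Kub VE h.
  have nuK : nu K = (fine (nu K))%:E by rewrite fineK// fin_num_measure.
  have {}h : V%:E - (n%:R^-1)%:E * lne (fine (nu K))%:E < a%:E + e%:E.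
    by rewrite -nuK; exact: h.
  have : 0 <= (fine (nu K))%:E by rewrite -nuK; exact: measure_ge0.
  rewrite lee_fin le_eqVlt => /orP[/eqP k0|k0].
    by move: h; rewrite -k0 /= lexx gt0_muleNy ?lte_fin ?invr_gt0 ?ltr0n.
  exists K, V, (fine (nu K)); split => //; split => //.
  by move: h; rewrite lne_EFin// -EFinM -EFinB -EFinD lte_fin; exact: ltW.
(* An infinite supremum is not compensated, since the penalty is nonnegative. *)
exfalso; move: h; rewrite ltNge addye ?leey//.
apply/eqP => E; have := penalty_ge0 (probability_le1 nu mK).
by rewrite E.
Qed.

End penalized.

Section tail.
Context (d : measure_display) (Y : measurableType d) (R : realType).
Variable mu : {sigma_finite_measure set Y -> \bar R}.
Context (G : set (set (Y -> R))) (M : countType).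
Local Notation F := (g_sigma_algebraType G).
Variables (w : M -> R) (prm : M -> probability F R) (S : M -> set F).
Variable pr : probability F R.
Hypothesis prior : mixing_prior mu w prm S pr.

(** Some model has positive weight; its support has full prior mass, so it is nonempty and needs at
    least one ball. Positivity keeps the logarithm in the bound away from [-oo]. *)
Lemma weighted_covering_gt0 (u r : R) : (forall m, covering_number mu r (S m) < +oo) ->
  0 < \esum_(m in [set: M]) ((w m `^ u)%:E * covering_number mu r (S m)).
Proof.
move=> hN.
have [m wm0] : exists m, (0 < w m)%R.
  apply: contrapT => nw; have := weights_sum1 prior; rewrite esum1 => [/eqP|m _].
    by rewrite eq_sym onee_eq0.
  congr EFin; apply/eqP; rewrite eq_le (weights_ge0 prior) andbT leNgt.
  by apply/negP => h; apply: nw; exists m.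
have [k [c [kE _ cover]]] := covering_numberP (hN m).
have N0 m' : 0 <= covering_number mu r (S m').
  by have [k' [c' [-> _ _]]] := covering_numberP (hN m'); rewrite lee_fin.
have Snonempty : S m !=set0.
  apply/set0P/eqP => S0; have := supports_full prior m.
  by rewrite S0 measure0 => /eqP; rewrite eq_sym onee_eq0.
have k0 : (0 < k)%N.
  by have [q Sq] := Snonempty; have [j jk _] := cover _ Sq; exact: leq_ltn_trans jk.
apply: (@lt_le_trans _ _ ((w m `^ u)%:E * covering_number mu r (S m))).
  by rewrite mule_gt0 ?lte_fin ?powR_gt0// kE lte_fin ltr0n.
apply: esum_ge; exists [set m]; last by rewrite fsbig_set1.
by split => //; exact: finite_set1.
Qed.

(** After the infinite cases are set aside, the bound on the averaged posterior mass is applied with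
    constants tuned to a decay like [n^(-2)], which is summable. *)
Lemma posterior_tail_le (d' : measure_display) (T : measurableType d')
  (Pr : probability T R) (p0 : Y -> R) (rho : T -> F) (u t : R) (n : nat) (B : \bar R) :
  is_density mu p0 -> (0 < n)%N -> (0 < u < 1)%R -> (0 < t)%R ->
  (forall m, covering_number mu (n%:R^-1 `^ u^-1)%R (S m) < +oo) ->
  (forall A : set F, measurable A -> A `<=` \bigcup_m S m ->
    Pr (rho @^-1` A) = iterated_integral mu n (fun s =>
      posterior pr (\bigcup_m S m) A s * (likelihood p0 s)%:E)) ->
  B = penalized_divergence mu n t p0 pr (\bigcup_m S m)
     + (n%:R^-1)%:E *
       lne ((n%:R `^ (2 * (u^-1 + t^-1)))%:E *
            (\esum_(m in [set: M])
               ((w m `^ u)%:E *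
                covering_number mu (n%:R^-1 `^ u^-1)%R (S m))) `^ u^-1) ->
  Pr (rho @^-1` [set q | (\bigcup_m S m) q /\ B < divergence mu (- u) p0 q]) <=
  ((expR (2 `^ u + u) + 1) * n%:R ^- 2)%:E.
Proof.
move=> dp0 n0 u01 t0 hN law BE; have /andP[u0 u1] := u01.
have n0R : (0 < n%:R :> R)%R by rewrite ltr0n.
have SD : \bigcup_m S m `<=` is_density mu by move=> q; apply: (support_density prior).
set A := [set q | _ /\ _].
have mA : measurable A by exact: (measurable_divergence_gt prior).
have AP : A `<=` \bigcup_m S m by move=> q [].
(* A density that violates the bound has a finite divergence, so [B] is below [+oo], and with it the
   weighted covering number and the penalized divergence. *)
have [->|/set0P[q0 [Pq0 Bq0]]] := eqVneq A set0.
  by rewrite preimage_set0 measure0 lee_fin mulr_ge0 ?addr_ge0 ?expR_ge0 ?invr_ge0 ?exprn_ge0.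
have Blty : B < +oo.
  exact: lt_trans Bq0 (divergence_neg_lty u01 dp0 (SD _ Pq0)).
rewrite law//.
have W0 := weighted_covering_gt0 u hN.
have aNy : penalized_divergence mu n t p0 pr (\bigcup_m S m) != -oo.
  by rewrite -ltNye; apply: lt_le_trans (penalized_divergence_ge n dp0 t0 pr SD); exact: ltNyr.
set Wb := \esum_(m in _) _ in W0 BE.
set c0 := (n%:R `^ (2 * (u^-1 + t^-1)))%R in BE.
have c00 : (0 < c0)%R by exact: powR_gt0.
have lnNy : lne (c0%:E * Wb `^ u^-1) != -oo.
  have : 0 < c0%:E * Wb `^ u^-1 by rewrite mule_gt0 ?poweR_gt0.
  by case: (c0%:E * _) => [x| |]//; rewrite lte_fin => x0; rewrite lne_EFin.
have [W WE] : exists W, Wb = W%:E.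
  case: Wb W0 BE lnNy => [W| |]// _ BE _; first by exists W.
  exfalso; move: Blty; rewrite BE poweRyr ?invr_eq0 ?gt_eqF//.
  by rewrite gt0_muley ?lte_fin//= gt0_muley ?lte_fin ?invr_gt0// addey ?ltxx.
have Wgt0 : (0 < W)%R by rewrite -lte_fin -WE.
have [a aE] : exists a, penalized_divergence mu n t p0 pr (\bigcup_m S m) = a%:E.
  case: (penalized_divergence mu n t p0 pr _) aNy BE => [a| |]// _ BE; first by exists a.
  exfalso; move: Blty; rewrite BE WE poweR_EFin -EFinM lne_EFin ?mulr_gt0 ?powR_gt0//.
have BE' : B = (a + n%:R^-1 * ln (c0 * W `^ u^-1))%:E.
  by rewrite BE aE WE poweR_EFin -EFinM lne_EFin ?mulr_gt0 ?powR_gt0.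
set eps := (a + n%:R^-1 * ln (c0 * W `^ u^-1))%R in BE'.
have ninv0 : (0 < n%:R^-1 :> R)%R by rewrite invr_gt0.
have [K [V [k [mK KP prK k0 [KV Vle]]]]] :=
  penalized_divergence_adherent dp0 t0 n0 SD ninv0 aE.
pose r : R := (n%:R^-1 `^ u^-1)%R.
have r0 : (0 < r)%R by exact: powR_gt0.
(* The radius is such that its [u]-th power is [1 / n]: over [n] observations the growth due to the
   diameter stays bounded. *)
have rE : ((r + r) `^ u = 2 `^ u * n%:R^-1)%R.
  have -> : (r + r = 2 * r)%R by ring.
  have ru : (r `^ u = n%:R^-1)%R.
    by rewrite /r -powRrM mulVf ?gt_eqF// powRr1// ltW.
  by rewrite (@powRM _ 2 r) ?(ltW r0)// ru.
have [N NP] := choice (fun m => covering_numberP (hN m)).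
have [c cP] := choice NP.
(* Threshold for the integrated likelihood of [K]: the exponential offsets the divergence on [K],
   and [n^(-2/t)] becomes [n^(-2)] after the power [t]. *)
pose b := (expR (- (n%:R * V)) * n%:R `^ (- (2 / t)))%R.
have b0 : (0 < b)%R by rewrite mulr_gt0 ?expR_gt0 ?powR_gt0.
(* An exponential upper bound for the one-observation factor [1 - u * eps + 2^u / n]. *)
pose gam := expR (- (u * eps) + 2 `^ u * n%:R^-1).
apply: (@le_trans _ _ (gam ^+ n * ((b * k) `^ (- u) * W) + expR (t * V) ^+ n * b `^ t)%:E).
  apply: (iterated_integral_posterior_le (r := r) (a := (1 - u * eps)%R)
    (N := N) (c := c) n prior dp0 mA AP mK KP u01 t0 r0 b0 prK k0 KV).
  - move=> q [Pq Bq]; have [mq q0' _] := SD _ Pq.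
    by apply: (lt_divergence_integral u01 dp0 mq q0'); rewrite -BE'.
  - by rewrite rE -addrA /gam; exact: expR_ge1Dx.
  - exact: expR_ge0.
  - by move=> m j jN; have [_ + _] := cP m; apply.
  - by move=> m f Sf; have [_ _] := cP m; apply.
  - rewrite -WE; apply: le_esum => m _.
    by have [<- _ _] := cP m.
by rewrite lee_fin; exact: (@tail_constant_le _ n u t V k a W eps b).
Qed.

End tail.

(** * Model-wise form of the penalized divergence *)

Lemma lneM_lty (R : realType) (x y : \bar R) : 0 <= x -> 0 <= y -> x < +oo -> y < +oo ->
  lne (x * y) = lne x + lne y.
Proof.
move=> x0 y0 xoo yoo.
(* At 0 both sides are [-oo]: finiteness excludes a sum of [-oo] and [+oo]. *)
have [->|xn0] := eqVneq x 0.
  rewrite mul0e /= lexx; case: y y0 yoo => [r| |]//=; by case: ifP.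
have [->|yn0] := eqVneq y 0.
  rewrite mule0 /= lexx; case: x x0 xoo xn0 => [r| |]//=; by case: ifP.
by apply: lneM; rewrite in_itv /= leey andbT lt0e ?xn0 ?yn0.
Qed.

Section mixture_bound.
Context (d : measure_display) (Y : measurableType d) (R : realType).
Variable mu : {sigma_finite_measure set Y -> \bar R}.
Context (G : set (set (Y -> R))) (M : countType).
Local Notation F := (g_sigma_algebraType G).
Variables (w : M -> R) (prm : M -> probability F R) (S : M -> set F).
Variable pr : probability F R.
Hypothesis prior : mixing_prior mu w prm S pr.
Variables (p0 : Y -> R) (t : R) (n : nat).
Hypotheses (dp0 : is_density mu p0) (t0 : (0 < t)%R) (n0 : (0 < n)%N).

Let modelwise : set (\bar R) := [set x : \bar R |
  exists (m : M) (K : set F), [/\ measurable K, K !=set0, K `<=` S m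
    & x = ereal_sup [set divergence mu t p0 q | q in K]
          - (n%:R^-1)%:E * lne ((w m)%:E * prm m K)]].

(** Restricting an infimum to the sets inside a single model can only increase it, and on those sets
    the mixture is one weighted model prior. *)
Lemma penalized_divergence_mixture_le :
  penalized_divergence mu n t p0 pr (\bigcup_m S m) <= ereal_inf modelwise.
Proof.
apply: le_ereal_inf => _ [m [K [mK K0 KS ->]]].
exists K; first by split => // q /KS Sq; exists m.
by rewrite (mixture_on_model prior mK KS).
Qed.

(** On a subset of one model the logarithm splits, and the part [- ln (w m) / n] does not depend on
    [K], so it leaves the infimum over [K]. *)
Lemma ereal_inf_modelwise : ereal_inf modelwise =
  ereal_inf [set penalized_divergence mu n t p0 (prm m) (S m)
                 - (n%:R^-1)%:E * lne ((w m)%:E) | m in [set: M]].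
Proof.
have ninv0 : (0 < n%:R^-1 :> R)%R by rewrite invr_gt0 ltr0n.
have SD m : S m `<=` is_density mu by exact: (supports_density prior).
have pen_ge m := penalized_divergence_ge n dp0 t0 (prm m) (SD m).
have termE m K : measurable K -> K !=set0 -> K `<=` S m ->
    ereal_sup [set divergence mu t p0 q | q in K]
      - (n%:R^-1)%:E * lne ((w m)%:E * prm m K) =
    (ereal_sup [set divergence mu t p0 q | q in K]
      - (n%:R^-1)%:E * lne (prm m K)) - (n%:R^-1)%:E * lne (w m)%:E.
  move=> mK K0 KS.
  have kfin : prm m K < +oo by apply: le_lt_trans (probability_le1 _ mK) (ltry _).
  rewrite lneM_lty ?ltry ?lee_fin ?(weights_ge0 prior)//.
  have : lne (prm m K) < +oo.
    by apply: le_lt_trans (ltry 0%R); rewrite lne_le0 probability_le1.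
  have : lne (w m)%:E < +oo by rewrite /=; case: ifP => _ //; rewrite ltry.
  case: (lne (w m)%:E) => [x| |]//; case: (lne (prm m K)) => [y| |]// _ _;
    case: (ereal_sup _) (sup_divergence_ge dp0 t0 K0 KS (SD m)) => [v| |]// _ /=;
    rewrite -?EFinM -?EFinD -?EFinN ?gt0_muleNy ?lte_fin//=.
  by congr EFin; ring.
apply/eqP; rewrite eq_le; apply/andP; split.
- apply: le_ereal_inf_tmp => _ [m _ <-].
  have : lne (w m)%:E < +oo by rewrite /=; case: ifP => _ //; rewrite ltry.
  have le_term K : measurable K -> K !=set0 -> K `<=` S m ->
      ereal_inf modelwise <= (ereal_sup [set divergence mu t p0 q | q in K]
      - (n%:R^-1)%:E * lne (prm m K)) - (n%:R^-1)%:E * lne (w m)%:E.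
    by move=> mK K0 KS; rewrite -termE//; apply: ereal_inf_lbound; exists m, K.
  move: le_term; case: (lne (w m)%:E) => [x| |]// le_term _; last first.
    (* Weight 0: the term of this model is [+oo], because its penalized divergence is not [-oo]. *)
    rewrite gt0_muleNy ?lte_fin//= addey ?leey// -ltNye.
    by apply: lt_le_trans (pen_ge m); exact: ltNyr.
  rewrite -EFinM leeBrDr//; apply: le_ereal_inf_tmp => _ [K [mK K0 KS] <-].
  by rewrite -leeBrDr// EFinM; exact: le_term.
- apply: le_ereal_inf_tmp => _ [m [K [mK K0 KS ->]]].
  rewrite termE//.
  apply: (@le_trans _ _ (penalized_divergence mu n t p0 (prm m) (S m)
                 - (n%:R^-1)%:E * lne ((w m)%:E))).
    by apply: ereal_inf_lbound; exists m.
  by apply: leeD2r; apply: ereal_inf_lbound; exists K.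
Qed.

End mixture_bound.

Theorem proposition7 (R : realType)
  (d : measure_display) (Y : measurableType d)
  (mu : {sigma_finite_measure set Y -> \bar R})
  (p0 : Y -> R) (p0_density : is_density mu p0)
  (G : set (set (Y -> R))) (M : countType)
  (w : M -> R) (prm : M -> probability (g_sigma_algebraType G) R)
  (S : M -> set (g_sigma_algebraType G))
  (pr : probability (g_sigma_algebraType G) R)
  (prior : mixing_prior mu w prm S pr)
  (d' : measure_display) (T : measurableType d') (Pr : probability T R)
  (p : nat -> T -> g_sigma_algebraType G)
  (post : posterior_sequence mu Pr pr (\bigcup_m S m) p0 p)
  (u t : R) (hu : exists2 k : nat, (2 <= k)%N & u = (k%:R^-1)%R)
  (ht : (0 < t)%R)
  (hN : forall (n : nat) (m : M), (0 < n)%N ->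
     covering_number mu (n%:R^-1 `^ u^-1)%R (S m) < +oo) :
  {ae Pr, forall x : T, \forall n \near \oo,
     divergence mu (- u)%R p0 (p n x) <=
     penalized_divergence mu n t p0 pr (\bigcup_m S m)
     + (n%:R^-1)%:E *
       lne ((n%:R `^ (2 * (u^-1 + t^-1)))%:E *
            (\esum_(m in [set: M])
               ((w m `^ u)%:E *
                covering_number mu (n%:R^-1 `^ u^-1)%R (S m))) `^ u^-1)}
  /\
  (forall n : nat, (0 < n)%N ->
     let I := ereal_inf [set x : \bar R |
       exists (m : M) (K : set (g_sigma_algebraType G)),
         [/\ measurable K, K !=set0, K `<=` S m
           & x = ereal_sup [set divergence mu t p0 q | q in K]
                 - (n%:R^-1)%:E * lne ((w m)%:E * prm m K)]] in
     penalized_divergence mu n t p0 pr (\bigcup_m S m) <= I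
     /\ I = ereal_inf [set penalized_divergence mu n t p0 (prm m) (S m)
                           - (n%:R^-1)%:E * lne ((w m)%:E) | m in [set: M]]).
Proof.
split=> [|n n0 I]; last first.
  split; first exact: (penalized_divergence_mixture_le prior).
  exact: (ereal_inf_modelwise prior).
have u01 : (0 < u < 1)%R.
  case: hu => k k2 ->; have k0 : (0 < k%:R :> R)%R by rewrite ltr0n ltnW.
  by rewrite invr_gt0 k0 invf_lt1// ltr1n.
pose B n := penalized_divergence mu n t p0 pr (\bigcup_m S m)
     + (n%:R^-1)%:E *
       lne ((n%:R `^ (2 * (u^-1 + t^-1)))%:E *
            (\esum_(m in [set: M])
               ((w m `^ u)%:E *
                covering_number mu (n%:R^-1 `^ u^-1)%R (S m))) `^ u^-1).
pose A n : set (g_sigma_algebraType G) :=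
  [set q | (\bigcup_m S m) q /\ B n < divergence mu (- u) p0 q].
(* The index is shifted by one, as the law of the sequence is prescribed for positive sample sizes
   only. *)
pose E n := p n.+1 @^-1` A n.+1.
have mE n : measurable (E n).
  have [mp _ _ _] := post n.+1 (ltn0Sn n).
  rewrite -[E n]setTI; apply: mp => //; exact: (measurable_divergence_gt prior).
have PE n : Pr (E n) <= ((expR (2 `^ u + u) + 1) * n.+1%:R ^- 2)%:E.
  have [_ _ _ law] := post n.+1 (ltn0Sn n).
  apply: (posterior_tail_le prior (t := t) (u := u)) => //.
  by move=> m; exact: hN.
have C0 : (0 <= expR (2 `^ u + u) + 1 :> R)%R by rewrite addr_ge0// expR_ge0.
(* The first Borel-Cantelli lemma, which requires nothing of the joint law. *)
have /(lim_sup_set_cvg0 mE) E0 : \sum_(n <oo) Pr (E n) < +oo.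
  apply: le_lt_trans (nneseries_inv_square_lty C0).
  by apply: lee_nneseries => // n _; exact: PE.
(* The exceptional set is only enclosed in this null set; its own measurability is not at issue. *)
exists (lim_sup_set E); split => //.
  by apply: bigcap_measurable => // n _; apply: bigcup_measurable => k _.
move=> x /= nx; apply: contrapT => nE; apply: nx.
have [n0 hn0] : exists n0, forall k, (n0 <= k)%N -> ~ E k x.
  apply: contrapT => h; apply: nE => n _.
  apply: contrapT => h'; apply: h; exists n => k nk Ek; apply: h'.
  by exists k.
(* Sample size [n.+1] belongs to the event [E n]. The draw lies in the support, so a violation of
   the bound would place it in [A n.+1], contrary to the choice of [n0]. *)
exists n0.+1 => // -[|n] //= n0n; rewrite leNgt; apply/negP => Bn.
have [_ pS _ _] := post n.+1 (ltn0Sn n).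
by apply: (hn0 n n0n); split; [exact: pS|exact: Bn].
Qed.
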